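(* For every graph $H$ there exists a constant $k$ such that every graph $G$ that does not contain $H$ as a strong immersion is nonrepetitively $k$-colourable.
   Context: All graphs are finite and simple. A $k$-colouring of a graph $G$ assigns one of $k$ colours to each vertex. A path $(v_1,\dots,v_{2s})$ of even order is repetitively coloured by $\psi$ if $\psi(v_i)=\psi(v_{s+i})$ for all $i\in\{1,\dots,s\}$; a colouring is nonrepetitive if no path of even order is repetitively coloured. $G$ contains $H$ as an immersion if the vertices of $H$ can be mapped to distinct vertices of $G$ (branch vertices) and the edges of $H$ to pairwise edge-disjoint paths in $G$, each edge $vw$ of $H$ mapped to a path with endpoints the images of $v$ and $w$. It is a strong immersion if additionally, for each edge $vw$ of $H$, no internal vertex of the corresponding path is a branch vertex. *)

(* Defs.v *)
From mathcomp Require Import all_boot.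
Set Implicit Arguments.
Unset Strict Implicit.
Unset Printing Implicit Defensive.

Record sgraph := SGraph {
  vert :> finType;
  adj : rel vert;
  adj_sym : symmetric adj;
  adj_irr : irreflexive adj
}.
Arguments adj {s}.

Section Paths.
Variable G : sgraph.

Definition edges : {set {set G}} :=
  [set e | [exists u : G, exists v : G, adj u v && (e == [set u; v])]].

(* The empty sequence satisfies this predicate; every use below excludes it. *)
Definition is_path (s : seq G) : bool := sorted adj s && uniq s.

Definition path_from_to (x y : G) (s : seq G) : Prop :=
  is_path s /\ exists p, s = x :: p /\ last x p = y.

(* Paths are undirected, so the sequence may be listed from either end. *)
Definition path_joins (x y : G) (s : seq G) : Prop :=
  path_from_to x y s \/ path_from_to y x s.

Definition path_edges (s : seq G) : seq {set G} :=
  [seq [set p.1; p.2] | p <- zip s (behead s)].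

Definition internal_vertices (s : seq G) : seq G :=
  if s is x :: p then behead (belast x p) else [::].

Definition repetitively_coloured (C : eqType) (psi : G -> C) (s : seq G) : Prop :=
  exists m, size s = m.*2 /\
    forall x0 i, i < m -> psi (nth x0 s i) = psi (nth x0 s (m + i)).

Definition nonrepetitive (C : eqType) (psi : G -> C) : Prop :=
  forall s, is_path s -> s <> [::] -> ~ repetitively_coloured psi s.

Definition nonrepetitively_colourable (k : nat) : Prop :=
  exists psi : G -> 'I_k, nonrepetitive psi.

End Paths.

Section Immersions.
Variables H G : sgraph.

(* P is indexed by 2-subsets of the vertices of H; its values off edges H are
   irrelevant. *)
Definition is_immersion (f : H -> G) (P : {set H} -> seq G) : Prop :=
  [/\ injective f,
      forall u v, adj u v -> path_joins (f u) (f v) (P [set u; v])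
    & forall e e', e \in edges H -> e' \in edges H -> e != e' ->
        [disjoint path_edges (P e) & path_edges (P e')]].

Definition is_strong_immersion (f : H -> G) (P : {set H} -> seq G) : Prop :=
  is_immersion f P /\
  forall e, e \in edges H ->
    forall w : H, f w \notin internal_vertices (P e).

Definition contains_strong_immersion : Prop :=
  exists f P, is_strong_immersion f P.

End Immersions.

(* Main.v *)
Require Import Defs.
From mathcomp Require Import all_boot order ssralg ssrnum ssrint zify.
Set Implicit Arguments.
Unset Strict Implicit.
Unset Printing Implicit Defensive.

(** If [G] contains a hub [w] and [#|H|] further vertices, each sending [#|H|]
    edge-disjoint paths to [w] that avoid the other ones, then routing every
    edge of [H] through [w] gives a strong immersion of [H].

    Let [Z] be a set of bounded size that no bounded separation splits evenly.
    Call a vertex free if no bounded separation cuts it off from [Z].  By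
    Menger's theorem, more than [#|H|] free vertices would yield such a hub, so
    there are few of them.  Every other vertex outside [Z] lies in an
    inclusion-maximal connected set [C], disjoint from [Z], with a bounded
    neighbourhood; by the theory of important separators each vertex lies in
    boundedly many of these sets.  Deleting the vertices that lie in some [C] and
    in no neighbourhood of such a set leaves a bag whose torso has bounded degree
    apart from [Z] and the free vertices, and the deleted components attach to
    boundedly many vertices.  Recursion decomposes [G] into such bags, glued
    along cliques of bounded order.

    A torso of bounded degree has a nonrepetitive colouring by Rosenfeld's
    counting argument, and exceptional vertices receive private colours.  The
    bags are combined by the Kundgen-Pelsmajer layering: glueing along cliques
    produces a shadow-complete layering whose layers have smaller adhesion, and
    the index of the layer is coloured by a square-free word together with its
    residue modulo 3. *)

(** * Edge-disjoint paths to a common end *)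

Definition arcs (T : Type) (s : seq T) : seq (T * T) := zip s (behead s).

Lemma arcs_cons (T : Type) (x y : T) p : arcs [:: x, y & p] = (x, y) :: arcs (y :: p).
Proof. by []. Qed.

Lemma mem_arcs (T : eqType) (s : seq T) a b :
  (a, b) \in arcs s -> (a \in s) && (b \in s).
Proof.
case: s => // x p; elim: p x => [|y p IHp] x //.
rewrite arcs_cons inE => /orP[/eqP[-> ->]|/IHp/andP[ha hb]].
  by rewrite !inE !eqxx orbT.
by rewrite !(in_cons x) ha hb !orbT.
Qed.

Lemma path_arcs (T : eqType) (r : rel T) x p a b :
  path r x p -> (a, b) \in arcs (x :: p) -> r a b.
Proof.
elim: p x => [|y p IHp] x //= /andP[rxy pth].
by rewrite inE => /orP[/eqP[-> ->]|/IHp]; last exact.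
Qed.

Section Flow.
Import Order.TTheory GRing.Theory Num.Theory.
Local Open Scope ring_scope.
Variables (T : finType) (w : T).
Implicit Types (phi : T -> T -> int) (r : seq T) (R S : {set T}).

Definition excess phi v : int := \sum_y phi v y.

(** A flow records the net transport across each pair, so opposite transports cancel by themselves,
    and [excess phi v] is the net amount leaving [v]. *)
Definition skew phi := forall a b, phi a b = - phi b a.

Fixpoint path_flow (x : T) (p : seq T) (a b : T) : int :=
  if p is y :: p' then
    ((a == x) && (b == y))%:R - ((b == x) && (a == y))%:R + path_flow y p' a b
  else 0.

Lemma path_flow_skew x p : skew (path_flow x p).
Proof.
move=> a b; elim: p x => [|y p IHp] x /=; first by rewrite oppr0.
by rewrite IHp opprD opprB.
Qed.

Lemma excess_path_flow x p v :
  excess (path_flow x p) v = (v == x)%:R - (v == last x p)%:R.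
Proof.
have aux (P : bool) (y : T) : \sum_z (P && (z == y))%:R = P%:R :> int.
  rewrite (bigD1 y) //= eqxx andbT big1 ?addr0 // => z /negPf ->.
  by rewrite andbF.
elim: p x => [|y p IHp] x /=; first by rewrite /excess big1 // subrr.
rewrite /excess /= big_split /= sumrB aux.
under [X in _ - X + _]eq_bigr do rewrite andbC.
by rewrite aux -/(excess _ _) IHp addrA subrK.
Qed.

Lemma path_flowE x p a b : uniq (x :: p) ->
  path_flow x p a b = ((a, b) \in arcs (x :: p))%:R - ((b, a) \in arcs (x :: p))%:R.
Proof.
elim: p x => [|y p IHp] x //= /andP[xp up].
rewrite IHp // !inE !xpair_eqE.
have h1 : (a == x) && ((a, b) \in arcs (y :: p)) = false.
  apply/negP => /andP[/eqP -> /mem_arcs/andP[h _]]; by rewrite h in xp.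
have h2 : (b == x) && ((b, a) \in arcs (y :: p)) = false.
  apply/negP => /andP[/eqP -> /mem_arcs/andP[h _]]; by rewrite h in xp.
rewrite -/(arcs (y :: p)); move: h1 h2.
by do 2![case: (_ \in arcs _)]; case: (a == x); case: (b == x); case: (a == y);
  case: (b == y).
Qed.

Lemma sum_excess phi R : skew phi ->
  \sum_(v in R) excess phi v = \sum_(v in R) \sum_(y in ~: R) phi v y.
Proof.
move=> sk.
have z : \sum_(v in R) \sum_(y in R) phi v y = 0.
  have : \sum_(v in R) \sum_(y in R) phi v y =
       - \sum_(v in R) \sum_(y in R) phi v y.
    rewrite {1}exchange_big /= -sumrN; apply: eq_bigr => x _.
    by rewrite -sumrN; apply: eq_bigr => y _.
  by lia.
transitivity (\sum_(v in R) \sum_(y in R) phi v y +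
              \sum_(v in R) \sum_(y in ~: R) phi v y); last by rewrite z add0r.
rewrite -big_split /=; apply: eq_bigr => v _.
rewrite /excess (bigID (mem R)) /=; congr (_ + _); apply: eq_bigl => y.
by rewrite !inE.
Qed.

Lemma sum_count_mem r R :
  \sum_(v in R) (count_mem v r)%:R = (count (mem R) r)%:R :> int.
Proof.
elim: r => [|u r IHr] /=; first by rewrite big1.
under eq_bigr do rewrite natrD; rewrite big_split /= IHr natrD; congr (_ + _).
have [uR|uR] := boolP (u \in R).
  rewrite (bigD1 u) //= eqxx big1 ?addr0 // => v /andP[_ /negPf].
  by rewrite eq_sym => ->.
by rewrite big1 // => v vR; case: eqP => // E; rewrite E vR in uR.
Qed.

(** Augmenting paths, one request at a time. If [w] is out of reach of [u] in the residual relation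
    [res], all arcs leaving the reachable set are saturated by the requests of [r] inside it; no
    room remains for [u], against the cut condition. *)
Lemma flow_exists (c : rel T) r :
  (forall S, w \notin S ->
     (count (mem S) r <= #|[set a | [&& a.1 \in S, a.2 \notin S & c a.1 a.2]]|)%N) ->
  exists phi, [/\ skew phi, forall a b, phi a b <= (c a b)%:R
    & forall v, v != w -> excess phi v = (count_mem v r)%:R].
Proof.
elim: r => [|u r IHr] cut.
  exists (fun _ _ => 0); split=> [a b|a b|v _]; rewrite ?oppr0 ?ler0n //.
  by rewrite /excess big1.
have [S wS|phi [sk cap ex]] := IHr; first by apply: leq_trans (cut S wS); rewrite /= leq_addl.
pose res a b := phi a b < (c a b)%:R.
have [/connectP[p0 pth0 lst0]|nwR] := boolP (connect res u w); last first.
  have [R RE] : exists R : {set T}, forall x, (x \in R) = connect res u x.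
    by exists [set x | connect res u x] => x; rewrite inE.
  have wR : w \notin R by rewrite RE.
  have := cut R wR; rewrite /= RE connect0.
  have : (count (mem R) r)%:R = #|[set a | [&& a.1 \in R, a.2 \notin R & c a.1 a.2]]|%:R :> int.
    rewrite -sum_count_mem.
    have -> : \sum_(v in R) (count_mem v r)%:R = \sum_(v in R) excess phi v.
      by apply: eq_bigr => v vR; rewrite ex //; apply: contraNneq wR => <-.
    rewrite sum_excess // pair_big_dep /= -sum1_card natr_sum.
    rewrite [RHS]big_mkcond /= [LHS]big_mkcond /=; apply: eq_bigr => -[a b] _ /=.
    rewrite in_setC inE /=; case: (boolP (a \in R)) => aR //=; case: (boolP (b \in R)) => bR //=.
    have : ~~ res a b.
      apply: contra bR => rab; rewrite !RE in aR *.
      exact: connect_trans aR (connect1 rab).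
    rewrite /res -leNgt => h; have := cap a b; case: (c a b) h => /=; lia.
  by move/eqP; rewrite eqr_nat => /eqP ->; rewrite add1n ltnn.
case/shortenP: pth0 lst0 => p pth up _ lst.
exists (fun a b => phi a b + path_flow u p a b); split=> [a b|a b|v vw].
- by rewrite sk path_flow_skew opprD.
- rewrite path_flowE //; have [/(path_arcs pth)|_] := boolP ((a, b) \in arcs _).
    by rewrite /res /=; case: (_ \in _) => /=; lia.
  by have := cap a b; case: (_ \in _) => /=; lia.
rewrite /excess big_split /= -!/(excess _ _) ex // excess_path_flow -lst (negPf vw).
by rewrite subr0 natrD eq_sym addrC.
Qed.

(** Paths of positive arcs are peeled off one by one; without one, the vertices reachable from [u]
    would have positive total excess but no flow out. As [phi] is at most 1, subtracting a path
    leaves no positive flow on its arcs, so later paths avoid them. *)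
Lemma flow_decomposition phi r :
  skew phi -> (forall a b, phi a b <= 1) ->
  (forall v, v != w -> excess phi v = (count_mem v r)%:R) ->
  exists L : seq (seq T),
    (forall i, (i < size r)%N ->
       [/\ path (fun a b => 0 < phi a b) (nth w r i) (nth [::] L i),
           last (nth w r i) (nth [::] L i) = w
         & uniq (nth w r i :: nth [::] L i)]) /\
    (forall i j ab, (i < j)%N -> (j < size r)%N ->
       ab \in arcs (nth w r i :: nth [::] L i) ->
       ab \notin arcs (nth w r j :: nth [::] L j)).
Proof.
elim: r phi => [|u r IHr] phi sk le1 ex; first by exists [::].
pose pos a b := 0 < phi a b.
have /connectP[p0 pth0 lst0] : connect pos u w.
  apply/negPn/negP => nwR.
  have [R RE] : exists R : {set T}, forall x, (x \in R) = connect pos u x.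
    by exists [set x | connect pos u x] => x; rewrite inE.
  have wR : w \notin R by rewrite RE.
  have : \sum_(v in R) excess phi v <= 0.
    rewrite sum_excess //; apply: sumr_le0 => v vR; apply: sumr_le0 => y.
    rewrite in_setC leNgt => yR; apply: contra yR => h; rewrite !RE in vR *.
    exact: connect_trans vR (connect1 h).
  have -> : \sum_(v in R) excess phi v = (count (mem R) (u :: r))%:R.
    rewrite -sum_count_mem.
    by apply: eq_bigr => v vR; rewrite ex //; apply: contraNneq wR => <-.
  by rewrite /= RE connect0 lern0.
case/shortenP: pth0 lst0 => p pth up _ lst.
pose psi a b := phi a b - path_flow u p a b.
have posW a b : 0 < psi a b -> pos a b /\ (a, b) \notin arcs (u :: p).
  rewrite /psi path_flowE //; have [ba|_] := boolP ((b, a) \in _).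
    have := path_arcs pth ba; rewrite /pos (sk b a).
    by case: (_ \in _) => /=; lia.
  by have := le1 a b; rewrite /pos; case: (_ \in _) => /=; split; lia.
have [||v vw|L [L1 L2]] := IHr psi.
- by move=> a b; rewrite /psi (sk a) path_flow_skew opprB opprK addrC.
- move=> a b; have [/posW[_ n]|] := ltrP 0 (psi a b); last by lia.
  rewrite /psi path_flowE // (negPf n); have := le1 a b.
  have [ba|_] := boolP ((b, a) \in _) => /=; last by lia.
  by have := path_arcs pth ba; rewrite /pos (sk b a); lia.
- rewrite /psi /excess sumrB -!/(excess _ _) ex // excess_path_flow -lst (negPf vw).
  by rewrite subr0 /= natrD eq_sym addrC addKr.
exists (p :: L); split=> [[|i]|[|i] [|j] ab] //= hi.
- by have [q1 q2 q3] := L1 i hi; split=> //; apply: sub_path q1 => a b /posW[].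
- move=> hj abp; apply/negP => abq; case: ab abp abq => a b abp.
  have [q1 _ _] := L1 j hj.
  by move/(path_arcs q1)/posW => [_]; rewrite abp.
by move=> hj; apply: L2.
Qed.

(** The paths follow positive flow, and an arc and its reverse are never both positive; this
    upgrades arc-disjointness to disjointness of undirected edges. *)
Theorem menger_arc_disjoint (c : rel T) r :
  (forall S, w \notin S ->
     (count (mem S) r <= #|[set a | [&& a.1 \in S, a.2 \notin S & c a.1 a.2]]|)%N) ->
  exists L : seq (seq T),
    (forall i, (i < size r)%N ->
       [/\ path c (nth w r i) (nth [::] L i),
           last (nth w r i) (nth [::] L i) = w
         & uniq (nth w r i :: nth [::] L i)]) /\
    (forall i j a b, (i < size r)%N -> (j < size r)%N -> i != j ->
       (a, b) \in arcs (nth w r i :: nth [::] L i) ->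
       ((a, b) \notin arcs (nth w r j :: nth [::] L j)) &&
       ((b, a) \notin arcs (nth w r j :: nth [::] L j))).
Proof.
move=> /flow_exists[phi [sk cap ex]].
have le1 a b : phi a b <= 1 by have := cap a b; case: (c a b) => /=; lia.
have [L [L1 L2]] := flow_decomposition sk le1 ex.
exists L; split=> [i ir|i j a b ir jr nij abi].
  have [q1 q2 q3] := L1 i ir; split=> //; apply: sub_path q1 => a b.
  by have := cap a b; case: (c a b) => //=; lia.
apply/andP; split.
  case: (ltngtP i j) nij => // lij _; first exact: L2 abi.
  by apply: contraL abi => /(L2 _ _ _ lij ir).
have [qi _ _] := L1 i ir; have [qj _ _] := L1 j jr.
apply/negP => /(path_arcs qj); have := path_arcs qi abi.
by rewrite (sk b a); lia.
Qed.

End Flow.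

(** * Strong immersions through a hub *)

Lemma path_arcs_self (T : eqType) (x : T) p : path (fun a b => (a, b) \in arcs (x :: p)) x p.
Proof.
elim: p x => [|y p IHp] x //=; rewrite inE eqxx /=.
by apply: sub_path (IHp y) => a b ab; rewrite inE orbC ab.
Qed.

Lemma set2_eqP (T : finType) (a b c d : T) : [set a; b] = [set c; d] ->
  (a = c /\ b = d) \/ (a = d /\ b = c).
Proof.
move=> E.
have /set2P ha : a \in [set c; d] by rewrite -E set21.
have /set2P hb : b \in [set c; d] by rewrite -E set22.
have /set2P hc : c \in [set a; b] by rewrite E set21.
have /set2P hd : d \in [set a; b] by rewrite E set22.
by case: ha hb hc hd => -> [] -> [] h1 [] h2; auto.
Qed.

Section Star.
Variables (H G : sgraph) (f : H -> G) (w : G) (c : rel G).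
Hypotheses (f_inj : injective f) (fw : forall h, f h != w).
Hypothesis cP : forall x y, c x y -> adj x y && (y \notin codom f).

(** One request per ordered pair, so each branch vertex asks for [#|H|] paths and the pair serves as
    the address of its path. *)
Definition requests : seq G := [seq f q.1 | q <- enum {: H * H}].

(* [w] is the hub: the edge [uv] of [H] is routed from [f u] to [w] along the
   path reserved for [(u, v)] and back along the one reserved for [(v, u)]. *)
Lemma star_strong_immersion :
  (forall S : {set G}, w \notin S -> count (mem S) requests <=
     #|[set a : G * G | [&& a.1 \in S, a.2 \notin S & c a.1 a.2]]|) ->
  contains_strong_immersion H G.
Proof.
move/menger_arc_disjoint => [L [L1 L2]].
pose idx (q : H * H) := index q (enum {: H * H}).
have idxS q : idx q < size requests by rewrite size_map index_mem mem_enum.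
have idx_inj : injective idx.
  move=> q q' /(congr1 (nth q (enum {: H * H}))).
  by rewrite !nth_index // mem_enum.
have reqE q : nth w requests (idx q) = f q.1.
  by rewrite /requests (nth_map q) ?nth_index ?index_mem // mem_enum.
pose p q := nth [::] L (idx q).
have pP q : [/\ path c (f q.1) (p q), last (f q.1) (p q) = w & uniq (f q.1 :: p q)].
  by have := L1 _ (idxS q); rewrite reqE.
have dis q q' a b : q != q' -> (a, b) \in arcs (f q.1 :: p q) ->
    ((a, b) \notin arcs (f q'.1 :: p q')) && ((b, a) \notin arcs (f q'.1 :: p q')).
  move=> ne; have := L2 (idx q) (idx q') a b (idxS q) (idxS q').
  by rewrite (inj_eq idx_inj) ne !reqE; apply.
have nobr q y : y \in p q -> y \notin codom f.
  have [+ _ _] := pP q; elim: (p q) (f q.1) => [|z s IHs] x //= /andP[xz ps].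
  by rewrite inE => /orP[/eqP ->|/(IHs z ps)//]; have /andP[] := cP xz.
pose sw (q : H * H) := (q.2, q.1).
(* The two reserved paths are joined at [w], [belast] dropping its second copy, and then shortened.
   The relation [rr] survives shortening: each step is an edge used, in some direction, by one of
   the two reserved paths. *)
pose walk q := p q ++ rev (belast (f q.2) (p (sw q))).
pose s q := f q.1 :: shorten (f q.1) (walk q).
pose rr q a b := adj a b && [|| (a, b) \in arcs (f q.1 :: p q), (b, a) \in arcs (f q.1 :: p q),
   (a, b) \in arcs (f q.2 :: p (sw q)) | (b, a) \in arcs (f q.2 :: p (sw q))].
have pn q : p q != [::].
  by have [_ + _] := pP q; case: (p q) => //= E; have := fw q.1; rewrite E eqxx.
have sP q : [/\ path (rr q) (f q.1) (shorten (f q.1) (walk q)), uniq (s q),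
    {subset shorten (f q.1) (walk q) <= walk q}
  & last (f q.1) (shorten (f q.1) (walk q)) = f q.2].
  have pw : path (rr q) (f q.1) (walk q).
    have [p1 l1 _] := pP q; have [p2 l2 _] := pP (sw q).
    rewrite /walk cat_path l1; apply/andP; split.
      have: path [rel a b | c a b && ((a, b) \in arcs (f q.1 :: p q))] (f q.1) (p q).
        by rewrite path_relI p1 path_arcs_self.
      by apply: sub_path => a b /andP[/cP/andP[ab _] h]; rewrite /rr ab h.
    rewrite -[X in path _ X]l2 rev_path.
    have: path [rel a b | c a b && ((a, b) \in arcs (f q.2 :: p (sw q)))] (f q.2) (p (sw q)).
      by rewrite path_relI p2 path_arcs_self.
    apply: sub_path => a b /andP[/cP/andP[ab _] h]; rewrite /rr adj_sym ab h.
    by rewrite !orbT.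
  have lw : last (f q.1) (walk q) = f q.2.
    rewrite /walk; have := pn (sw q); case: (p (sw q)) => //= z t _.
    by rewrite rev_cons last_cat last_rcons.
  by rewrite /s -lw; case/shortenP: pw => t pt ut st; split.
(* Either orientation of the edge may be picked, since [path_joins] ignores direction. *)
pose P (e : {set H}) : seq G :=
  if [pick q : H * H | adj q.1 q.2 && (e == [set q.1; q.2])] is Some q then s q else [::].
have PP u v : adj u v -> exists q, [/\ adj q.1 q.2, [set u; v] = [set q.1; q.2]
    & P [set u; v] = s q].
  move=> uv; rewrite /P; case: pickP => [q /andP[q1 /eqP q2]|/(_ (u, v))]; first by exists q.
  by rewrite /= uv eqxx.
have PE e : e \in edges H -> exists q, [/\ adj q.1 q.2, e = [set q.1; q.2] & P e = s q].
  by rewrite inE => /existsP[u /existsP[v /andP[uv /eqP ->]]]; apply: PP.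
exists f, P; split; first split=> //.
- move=> u v /PP[q [aq E ->]]; have [p1 u1 _ l1] := sP q.
  have: path_from_to (f q.1) (f q.2) (s q).
    split; first by rewrite /is_path u1 andbT /=; apply: sub_path p1 => a b /andP[].
    by exists (shorten (f q.1) (walk q)).
  by case: (set2_eqP E) => -[-> ->]; [left|right].
- move=> e e' /PE[q [_ E ->]] /PE[q' [_ E' ->]] ne.
  rewrite disjoint_has; apply/hasPn => ed /mapP[[a b] ab E1]; apply/negP => /mapP[[a' b'] ab' E2].
  have [p1 _ _ _] := sP q; have [p1' _ _ _] := sP q'.
  have loc q0 x y : rr q0 x y -> exists2 q1, [set q1.1; q1.2] = [set q0.1; q0.2] &
      ((x, y) \in arcs (f q1.1 :: p q1)) || ((y, x) \in arcs (f q1.1 :: p q1)).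
    case/andP=> _ /or4P[] h; [exists q0|exists q0|exists (sw q0)|exists (sw q0)];
      by rewrite ?h ?orbT // setUC.
  have [q1 q1E h1] := loc _ _ _ (path_arcs p1 ab).
  have [q2 q2E h2] := loc _ _ _ (path_arcs p1' ab').
  have nq : q1 != q2.
    by apply: contraNneq ne => q12; rewrite E E' -q1E -q2E q12.
  have {E1 E2} /set2_eqP[[/= ? ?]|[/= ? ?]] : [set a; b] = [set a'; b'] by rewrite -E1 E2.
    subst a' b'; case/orP: h1 => /(dis _ _ _ _ nq)/andP[n1 n2];
      by move: h2; rewrite (negPf n1) (negPf n2).
  subst a' b'; case/orP: h1 => /(dis _ _ _ _ nq)/andP[n1 n2];
      by move: h2; rewrite (negPf n1) (negPf n2).
move=> e /PE[q [aq _ ->]] h; have [_ u1 sub l1] := sP q.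
rewrite /s /=; move: u1 sub l1; rewrite /s.
case/lastP: (shorten _ _) => [|t z] //; rewrite belast_rcons last_rcons /= => u1 sub zE.
(* Reserved paths enter no branch vertex, so a branch vertex in [walk q] can only be [f q.2]. That
   is the last vertex [z], which uniqueness keeps out of [t]. *)
apply/negP => ht; have : f h \in walk q by apply: sub; rewrite mem_rcons inE ht orbT.
move: u1; rewrite mem_rcons inE negb_or rcons_uniq => /andP[/andP[_ n1] /andP[n2 _]].
rewrite mem_cat => /orP[/nobr|]; first by rewrite codom_f.
rewrite mem_rev; have := nobr (sw q) (f h); case: (p (sw q)) => //= y r nb.
rewrite inE => /orP[/eqP fh|/mem_belast /nb]; first by rewrite zE -fh ht in n2.
by rewrite codom_f.
Qed.

End Star.

(** * Important separators *)

Section Separators.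
Variables (T : finType) (g : rel T).
Hypothesis g_sym : symmetric g.
Implicit Types (C D K O P X : {set T}).

Definition nbh C := [set y | (y \notin C) && [exists x in C, g x y]].

Lemma nbhP C y : reflect (y \notin C /\ exists2 x, x \in C & g x y) (y \in nbh C).
Proof.
rewrite inE; apply: (iffP andP) => [[yC /exists_inP[x xC xy]]|[yC [x xC xy]]].
  by split=> //; exists x.
by split=> //; apply/exists_inP; exists x.
Qed.

Lemma nbh_edge C x y : x \in C -> g x y -> (y \in C) || (y \in nbh C).
Proof.
by move=> xC xy; have [//|yC] := boolP (y \in C); apply/nbhP; split=> //; exists x.
Qed.

Lemma nbh_disjoint C : [disjoint C & nbh C].
Proof. by rewrite disjoint_subset; apply/subsetP => x xC; rewrite !inE xC. Qed.

(** Both the union and the intersection of the two sets on the left are contained in those of the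
    two sets on the right. *)
Lemma nbh_submodular C1 C2 D :
  #|nbh (C1 :|: C2) :\: D| + #|nbh (C1 :&: C2) :\: D| <=
  #|nbh C1 :\: D| + #|nbh C2 :\: D|.
Proof.
rewrite -cardsUI -[leqRHS]cardsUI leq_add // subset_leq_card //; apply/subsetP => y.
  rewrite in_setU !in_setD [in X in _ -> X]in_setU !in_setD -!andb_orr.
  case/andP=> -> /= /orP[] /nbhP[+ [x]]; rewrite !inE.
    rewrite negb_or => /andP[y1 y2] /orP[xC|xC] xy; apply/orP; [left|right];
      by apply/andP; split=> //; apply/exists_inP; exists x.
  rewrite negb_and => /orP[yC|yC] /andP[x1 x2] xy; apply/orP; [left|right];
      by apply/andP; split=> //; apply/exists_inP; exists x.
rewrite in_setI !in_setD [in X in _ -> X]in_setI !in_setD.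
case/andP=> /andP[-> /nbhP[+ _]] /andP[_ /nbhP[_ [x]]]; rewrite !inE negb_or.
by move=> /andP[-> ->] /andP[x1 x2] xy; apply/andP; split; apply/exists_inP; exists x.
Qed.

(** Connectedness as an induction principle: whatever meets [C] and is closed under edges inside [C]
    exhausts it. The empty set qualifies, hence the nonemptiness clause in [adm]. *)
Definition conn C := [forall P : {set T}, (P :&: C != set0) &&
  [forall x in P :&: C, forall y in C, g x y ==> (y \in P)] ==> (C \subset P)].

Lemma connP C : reflect
  (forall P x0, x0 \in P -> x0 \in C ->
     (forall x y, x \in P -> x \in C -> y \in C -> g x y -> y \in P) -> C \subset P)
  (conn C).
Proof.
apply: (iffP forallP) => [h P x0 xP xC cl|h P].
  have /implyP := h P; apply; apply/andP; split.
    by apply/set0Pn; exists x0; rewrite inE xP.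
  apply/forall_inP => x; rewrite inE => /andP[xP' xC'].
  by apply/forall_inP => y yC; apply/implyP; apply: cl.
apply/implyP => /andP[/set0Pn[x0]]; rewrite inE => /andP[xP xC] /forall_inP cl.
apply: (h P x0) => // x y xP' xC' yC xy.
have xPC : x \in P :&: C by rewrite inE xP'.
by have /forall_inP/(_ y yC)/implyP := cl x xPC; apply.
Qed.

Lemma conn1 x : conn [set x].
Proof. by apply/connP => P y yP /set1P E _; rewrite sub1set -E. Qed.

Lemma conn_add C v : conn C -> v \in nbh C -> conn (v |: C).
Proof.
move=> /connP cC /nbhP[vC [u uC uv]]; apply/connP => P x0 xP xC cl.
have CP : C \subset P.
  have [x xP' xC'] : exists2 x, x \in P & x \in C.
    case/setU1P: xC => [xv|]; last by exists x0.
    exists u => //; apply: (cl x0) => //; rewrite ?inE ?xv ?eqxx ?uC ?orbT //.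
    by rewrite g_sym.
  apply: (cC P x) => // a b aP aC bC; apply: cl => //; by rewrite inE ?aC ?bC orbT.
rewrite subUset sub1set CP andbT; apply: (cl u) => //.
- exact: (subsetP CP).
- by rewrite inE uC orbT.
- by rewrite inE set11.
Qed.

Lemma conn_union C1 C2 x : conn C1 -> conn C2 -> x \in C1 -> x \in C2 ->
  conn (C1 :|: C2).
Proof.
move=> /connP c1 /connP c2 x1 x2; apply/connP => P y yP yC cl.
have cl1 a b : a \in P -> a \in C1 -> b \in C1 -> g a b -> b \in P.
  by move=> aP aC bC; apply: cl => //; rewrite inE ?aC ?bC.
have cl2 a b : a \in P -> a \in C2 -> b \in C2 -> g a b -> b \in P.
  by move=> aP aC bC; apply: cl => //; rewrite inE ?aC ?bC orbT.
rewrite subUset; case/setUP: yC => yC.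
  have s1 := c1 P y yP yC cl1; rewrite s1 /=.
  exact: c2 (subsetP s1 _ x1) x2 cl2.
have s2 := c2 P y yP yC cl2; rewrite s2 andbT.
exact: c1 (subsetP s2 _ x2) x1 cl1.
Qed.

Lemma component X O : conn X -> X \subset O ->
  exists K, [/\ conn K, X \subset K, K \subset O & [disjoint nbh K & O]].
Proof.
move=> cX sXO; have [|K /maxsetP[/andP[cK sKO] mK] sXK] :=
  maxset_exists (P := fun K => conn K && (K \subset O)) (C := X); first by rewrite cX.
exists K; split=> //; rewrite disjoint_subset; apply/subsetP => y yK; rewrite inE.
apply/negP => yO; have yK' : y \in K.
  rewrite -(mK (y |: K)) ?setU11 ?subsetUr ?conn_add //= subUset sub1set yO.
  exact: sKO.
by have /nbhP[] := yK; rewrite yK'.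
Qed.

Lemma component_nbh K O : K \subset O -> [disjoint nbh K & O] -> nbh K \subset nbh O.
Proof.
move=> sKO dKO; apply/subsetP => y yK; apply/nbhP; split.
  by rewrite (disjointFr dKO yK).
by have /nbhP[_ [x xK xy]] := yK; exists x => //; apply: (subsetP sKO).
Qed.

Section Important.
Variables (X0 : {set T}) (k : nat).

(** The neighbourhoods of inclusion-maximal admissible sets play the role of important separators,
    with [X0] as the side to be cut off. *)
Definition adm C := [&& C != set0, conn C, [disjoint C & X0] & #|nbh C| <= k].

(* The branching argument bounding the number of important separators: a
   vertex [v] of the furthest minimum separator is either in the separator of
   [C] (and goes to [D]) or in [C]. *)
Lemma important_family_bound m X D lam : X != set0 -> conn X ->
  (forall C, X \subset C -> [disjoint C & X0] -> [disjoint C & D] ->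
     lam <= #|nbh C :\: D|) ->
  2 * k <= m + lam + 2 * #|D| ->
  #|[set C | [&& maxset adm C, X \subset C & D \subset nbh C]]| <= 2 ^ m.
Proof.
elim/ltn_ind: m X D lam => m IHm X D lam Xn0 cX low meas.
set Fam := [set C | _].
have [->|[C0 C0F]] := set_0Vmem Fam; first by rewrite cards0.
have FamP C : C \in Fam -> [/\ maxset adm C, conn C, [disjoint C & X0], #|nbh C| <= k
    & [/\ X \subset C, D \subset nbh C & [disjoint C & D]]].
  rewrite inE => /and3P[mC sXC sDC]; have /maxsetP[/and4P[_ cC dC nC] _] := mC.
  by split=> //; split=> //; apply: disjointWr sDC (nbh_disjoint C).
pose cand C := [&& conn C, X \subset C, [disjoint C & X0] & [disjoint C & D]].
have [_ _ dX0 nC0 [sXC0 sDC0 dD0]] := FamP _ C0F.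
have candX : cand X by rewrite /cand cX subxx (disjointWl sXC0 dX0) (disjointWl sXC0 dD0).
case: (arg_minnP (fun C : {set T} => #|nbh C :\: D|) candX) => C1 candC1 minC1.
pose l0 := #|nbh C1 :\: D|.
have l0P C : X \subset C -> [disjoint C & X0] -> [disjoint C & D] -> l0 <= #|nbh C :\: D|.
  move=> sXC dC dD; have [K [cK sXK sKC dK]] := component cX sXC.
  apply: leq_trans (minC1 K _) _.
    by rewrite /cand cK sXK (disjointWl sKC dC) (disjointWl sKC dD).
  by rewrite subset_leq_card // setSD // component_nbh.
(* [Cs] is the furthest minimum separator: inclusion-maximal among the candidates attaining [l0]. *)
have [|Cs /maxsetP[/andP[candCs leCs] mCs] sC1s] := maxset_exists
  (P := fun C => cand C && (#|nbh C :\: D| <= l0)) (C := C1); first by rewrite candC1 /=.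
have /and4P[cCs sXCs dCs dDs] := candCs.
have eqCs : #|nbh Cs :\: D| = l0 by apply/eqP; rewrite eqn_leq leCs l0P.
have [x0 x0X] := set0Pn _ Xn0.
(* Outside [D], the set [C :&: Cs] has at least [l0] neighbours, so by submodularity [C :|: Cs] has
   no more than [C]. Hence [C :|: Cs] is admissible and equals [C] by maximality. *)
have sub C : C \in Fam -> Cs \subset C.
  move=> CF; have [/maxsetP[_ mC] cC dC nC [sXC sDC dD]] := FamP _ CF.
  have := nbh_submodular C Cs D; rewrite eqCs.
  have := l0P (C :&: Cs); rewrite subsetI sXC sXCs (disjointWl (subsetIl C Cs) dC)
    (disjointWl (subsetIl C Cs) dD) => /(_ isT isT isT) h1 h2.
  have h3 : #|nbh C :\: D| + #|D| = #|nbh C|.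
    by rewrite -[RHS](cardsID D) addnC (setIidPr sDC).
  have h4 : #|nbh (C :|: Cs)| <= #|nbh (C :|: Cs) :\: D| + #|D|.
    by rewrite -(cardsID D) addnC leq_add2l subset_leq_card ?subsetIr.
  rewrite -(mC (C :|: Cs)) ?subsetUl ?subsetUr //; apply/and4P; split.
  - by apply/set0Pn; exists x0; rewrite inE (subsetP sXC).
  - by apply: (conn_union (x := x0)) => //; apply: (subsetP _ _ x0X).
  - by rewrite disjoints_subset subUset -!disjoints_subset dC dCs.
  by move: h1 h2 h3 h4 nC; clear; lia.
have l0k : l0 + #|D| <= k.
  by apply: leq_trans nC0; rewrite -(cardsID D (nbh C0)) addnC (setIidPr sDC0) leq_add2l l0P.
have leml : lam <= l0 by have /and4P[_ h1 h2 h3] := candC1; apply: low.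
(* If [Cs] has no neighbour outside [D], a connected set disjoint from [D] cannot leave it, so [Cs]
   is the only possible member. *)
have [l0z|l0p] := posnP l0.
  apply: leq_trans (_ : #|[set Cs]| <= _); last by rewrite cards1 expn_gt0.
  apply/subset_leq_card/subsetP => C CF; rewrite inE eqEsubset (sub _ CF) andbT.
  have [_ /connP cC _ _ [sXC _ dD]] := FamP _ CF.
  apply: (cC Cs x0); rewrite ?(subsetP sXCs) ?(subsetP sXC) // => x y xs _ yC xy.
  case/orP: (nbh_edge xs xy) => // yN; move/eqP: eqCs; rewrite l0z cards_eq0.
  move/eqP/setP/(_ y); rewrite !inE (disjointFr dD yC) /=.
  by move: yN; rewrite inE => ->.
have m_gt0 : 0 < m by move: meas leml l0k l0p; clear; lia.
have m1 : m.-1 < m by rewrite prednK.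
have [v] : exists v, v \in nbh Cs :\: D by apply/set0Pn; rewrite -cards_eq0 eqCs -lt0n.
rewrite inE => /andP[vD vN].
have vCs : v \notin Cs by have /nbhP[] := vN.
have Csn0 : Cs != set0 by apply/set0Pn; exists x0; apply: (subsetP sXCs).
have -> : 2 ^ m = 2 ^ m.-1 + 2 ^ m.-1 by rewrite addnn -mul2n -expnS prednK.
(* The measure [2 * k - lam - 2 * #|D|] drops in both branches: [F1] adds [v] to [D] while [lam]
   becomes [l0.-1]; [F2] keeps [D] while [lam] becomes [l0.+1], as no larger candidate attains
   [l0]. *)
pose F1 := [set C | [&& maxset adm C, Cs \subset C & v |: D \subset nbh C]].
pose F2 := [set C | [&& maxset adm C, v |: Cs \subset C & D \subset nbh C]].
have cover : Fam \subset F1 :|: F2.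
  apply/subsetP => C CF; have [mC _ _ _ [_ sDC _]] := FamP _ CF; have sC := sub _ CF.
  rewrite !inE mC sC sDC !subUset !sub1set sC sDC !andbT /=.
  have /nbhP[_ [x xC xv]] := vN.
  by have := nbh_edge (subsetP sC _ xC) xv; rewrite orbC.
apply: leq_trans (subset_leq_card cover) _; apply: leq_trans (leq_card_setU _ _) _.
apply: leq_add.
  apply: (IHm _ m1 _ _ l0.-1) => //; last by rewrite cardsU1 vD; move: meas leml l0p m_gt0; clear; lia.
  move=> C sC dC dD.
  have := l0P C (subset_trans sXCs sC) dC; rewrite (disjointWr (subsetUr [set v] D)) //.
  move=> /(_ isT) h.
  have h2 : #|nbh C :\: D| <= #|nbh C :\: (v |: D)| + 1.
    rewrite -(cards1 v); apply: leq_trans (leq_card_setU _ _).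
    by apply/subset_leq_card/subsetP => y; rewrite !inE; case: (y == v); rewrite ?orbT ?orbF.
  by move: h h2; clear; lia.
apply: (IHm _ m1 _ _ l0.+1); first by apply/set0Pn; exists v; rewrite setU11.
- exact: conn_add.
- move=> C sC dC dD; rewrite ltnNge; apply/negP => leC.
  have [K [cK sK sKC dK]] := component (conn_add cCs vN) sC.
  have sCsK := subset_trans (subsetUr [set v] Cs) sK.
  have EK : K = Cs.
    apply: mCs => //; rewrite /cand cK (disjointWl sKC dC) (disjointWl sKC dD).
    rewrite (subset_trans sXCs sCsK) /=; apply: leq_trans leC.
    by rewrite subset_leq_card // setSD // component_nbh.
  by move: vCs; rewrite -EK (subsetP sK) // setU11.
by move: meas leml m_gt0; clear; lia.
Qed.

(** The branching starts from [X = [set s]], empty [D] and [lam = 0], hence with measure [2 * k]. *)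
Lemma important_bound s : #|[set C | maxset adm C & s \in C]| <= 4 ^ k.
Proof.
have := @important_family_bound (2 * k) [set s] set0 0 _ (conn1 s).
rewrite cards0 !addn0 leqnn (expnM 2 2) => h.
apply: leq_trans (h _ _ isT) => //; last by apply/set0Pn; exists s; rewrite set11.
by apply/subset_leq_card/subsetP => C; rewrite !inE sub1set sub0set andbT.
Qed.

End Important.
End Separators.

(** * Free vertices *)

Lemma injection_into (A B : finType) (S : {set B}) : #|A| <= #|S| ->
  exists2 f : A -> B, injective f & forall a, f a \in S.
Proof.
move=> le; exists (fun a => enum_val (widen_ord le (enum_rank a))) => [a b|a].
  by move=> /enum_val_inj/(congr1 val)/= /val_inj/enum_rank_inj.
exact: enum_valP.
Qed.

Section Free.
Variables (H G : sgraph).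
Hypothesis noimm : ~ contains_strong_immersion H G.
Variables (V Z : {set G}).
Let N := #|H|.
(** A violated cut has at most [N * N] arcs; their ends on one side, together with at most [N]
    branch vertices, form the overlap of a separation. *)
Let p := N * N + N.
Hypothesis Z_big : 4 * p <= #|Z|.

Definition induced (x y : G) := [&& adj x y, x \in V & y \in V].

Lemma induced_sym : symmetric induced.
Proof. by move=> x y; rewrite /induced adj_sym; congr (_ && _); rewrite andbC. Qed.

Definition separation (A B : {set G}) := (A :|: B == V) &&
  [forall x in A :\: B, forall y in B :\: A, ~~ adj x y].

Lemma separationP A B : reflect (A :|: B = V /\
  forall x y, x \in A -> x \notin B -> y \in B -> y \notin A -> ~~ adj x y) (separation A B).
Proof.
apply: (iffP andP) => -[/eqP E h]; split=> //.
  move=> x y xA xB yB yA; have /forall_inP := h => /(_ x); rewrite inE xA xB => /(_ isT).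
  by move=> /forall_inP; apply; rewrite inE yA.
apply/forall_inP => x; rewrite inE => /andP[xB xA]; apply/forall_inP => y.
by rewrite inE => /andP[yA yB]; apply: h.
Qed.

Hypothesis unsplit : forall A B, separation A B -> #|A :&: B| <= p ->
  #|Z :\: A| < p \/ #|Z :\: B| < p.

(** The threshold [2 * p] adds the overlap of a separation, at most [p], to the fewer than [p]
    vertices of [Z] missed by one side. *)
Definition free := [set x in V :\: Z |
  [forall C : {set G}, (x \in C) && (C \subset V :\: Z) ==> (2 * p < #|nbh induced C|)]].

Lemma freeP x (C : {set G}) : x \in free -> x \in C -> C \subset V :\: Z -> 2 * p < #|nbh induced C|.
Proof. by rewrite inE => /andP[_ /forallP/(_ C)/implyP h] xC sC; apply: h; rewrite xC. Qed.

(** Otherwise one free vertex [w] becomes the hub and [N] others the branch vertices, and a violated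
    cut [S] gives two separations. As some [f h] in [S] is free, [A1] contains most of [Z]; as [w]
    outside [S] is free, so does [B2]. But [A1] and [B2] share at most [2 * N * N + N] vertices, too
    few for the size of [Z]. *)
Lemma free_few : #|free| <= N.
Proof.
rewrite leqNgt; apply/negP => big; apply: noimm.
have [w wF] : exists w, w \in free by apply/set0Pn; rewrite -card_gt0; apply: leq_ltn_trans big.
have [f f_inj fF] : exists2 f : H -> G, injective f & forall h, f h \in free :\ w.
  by apply: injection_into; have := cardsD1 w free; rewrite wF; move: big; rewrite /N; clear; lia.
have fw h : f h != w by have := fF h; rewrite !inE => /andP[].
have {}fF h : f h \in free by have := fF h; rewrite inE => /andP[].
have freeV x : x \in free -> (x \in V) && (x \notin Z) by rewrite inE in_setD => /andP[/andP[-> ->]].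
pose U := [set x in codom f].
have cU : #|U| <= N by rewrite /U cardsE; apply: leq_trans (card_size _) _; rewrite size_codom.
pose c x y := induced x y && (y \notin codom f).
pose arc (S : {set G}) := [set a : G * G | [&& a.1 \in S, a.2 \notin S & c a.1 a.2]].
apply: (@star_strong_immersion H G f w c) => // [x y /andP[/and3P[-> _ _] ->] //|S wS].
rewrite leqNgt; apply/negP; rewrite -/(arc S) => lt.
have sreq : size (requests f) = N * N.
  by rewrite size_map -cardE card_prod.
have arcN : #|arc S| <= N * N.
  by apply: leq_trans (ltnW lt) _; rewrite -sreq count_size.
have [h hS] : exists h, f h \in S.
  have : has (mem S) (requests f) by rewrite has_count; apply: leq_ltn_trans lt.
  by case/hasP => _ /mapP[q _ ->] qS; exists q.1.
pose ra := snd @: arc S; pose sa := fst @: arc S.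
have cra : #|ra| <= N * N := leq_trans (leq_imset_card _ _) arcN.
have csa : #|sa| <= N * N := leq_trans (leq_imset_card _ _) arcN.
have arcE x y : x \in S -> y \notin S -> y \notin U -> induced x y -> (x \in sa) && (y \in ra).
  rewrite inE => xS yS yU xy.
  have a : (x, y) \in arc S by rewrite inE /= xS yS /c xy yU.
  by apply/andP; split; apply/imsetP; exists (x, y).
have UV x : x \in U -> x \in V.
  by rewrite inE => /codomP[h' ->]; have /andP[] := freeV _ (fF h').
have raV x : x \in ra -> x \in V.
  by case/imsetP => -[a b]; rewrite inE => /and3P[_ _ /andP[/and3P[_ _ h'] _]] ->.
have saV x : x \in sa -> x \in V.
  by case/imsetP => -[a b]; rewrite inE => /and3P[_ _ /andP[/and3P[_ h' _] _]] ->.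
have raS x : x \in ra -> x \notin S.
  by case/imsetP => -[a b]; rewrite inE => /and3P[_ h' _] ->.
have saS x : x \in sa -> x \in S.
  by case/imsetP => -[a b]; rewrite inE => /and3P[h' _ _] ->.
have card2 (X Y1 Y2 : {set G}) n1 n2 : X \subset Y1 :|: Y2 -> #|Y1| <= n1 -> #|Y2| <= n2 ->
    #|X| <= n1 + n2.
  move=> s l1 l2; apply: leq_trans (subset_leq_card s) _.
  exact: leq_trans (leq_card_setU _ _) (leq_add l1 l2).
(* Arcs into [U] are invisible to [c], so [U] joins both overlaps. Adding the heads [ra] encloses
   the side [S]; adding the tails [sa] encloses the complementary side. *)
pose A1 := (S :&: V) :|: (U :|: ra); pose B1 := V :\: S.
pose A2 := (S :&: V) :|: U; pose B2 := (V :\: S) :|: sa.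
have sep1 : separation A1 B1.
  apply/separationP; split=> [|x y].
    apply/setP => x; rewrite /A1 /B1 !in_setU in_setI in_setD.
    have [xS|xS] := boolP (x \in S) => /=; case: (boolP (x \in V)) => xV //=.
    - by apply/negP => /orP[/orP[/UV|/raV]|//]; rewrite (negPf xV).
    - by rewrite orbT.
    - by apply/negP => /orP[/orP[/UV|/raV]|//]; rewrite (negPf xV).
  rewrite /A1 /B1 !in_setU !in_setI !in_setD => xA xB /andP[yS yV].
  rewrite (negPf yS) /= negb_or => /andP[yU yr]; apply/negP => xy.
  have xV : x \in V by case/orP: xA => [/andP[]|/orP[/UV|/raV]].
  rewrite xV andbT negbK in xB.
  have /andP[_ yr'] : (x \in sa) && (y \in ra) by apply: arcE => //; rewrite /induced xy xV.
  by rewrite yr' in yr.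
have sep2 : separation A2 B2.
  apply/separationP; split=> [|x y].
    apply/setP => x; rewrite /A2 /B2 !in_setU in_setI in_setD.
    have [xS|xS] := boolP (x \in S) => /=; case: (boolP (x \in V)) => xV //=.
    - by apply/negP => /orP[/UV|/saV]; rewrite (negPf xV).
    - by rewrite orbT.
    - by apply/negP => /orP[/UV|/saV]; rewrite (negPf xV).
  rewrite /A2 /B2 !in_setU !in_setI !in_setD !negb_or => xA /andP[xB xs] yB /andP[yS yU].
  apply/negP => xy.
  have xV : x \in V by case/orP: xA => [/andP[]|/UV].
  rewrite xV andbT negbK in xB.
  have yV : y \in V by case/orP: yB => [/andP[]|/saV].
  rewrite yV andbT in yS.
  have /andP[xs' _] : (x \in sa) && (y \in ra) by apply: arcE => //; rewrite /induced xy xV.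
  by rewrite xs' in xs.
have o1 : #|A1 :&: B1| <= p.
  rewrite /p addnC; apply: (card2 _ U ra) => //; apply/subsetP => x.
  rewrite /A1 /B1 in_setI !in_setU in_setI in_setD => /andP[+ /andP[xS _]].
  by rewrite (negPf xS).
have o2 : #|A2 :&: B2| <= p.
  rewrite /p addnC; apply: (card2 _ U sa) => //; apply/subsetP => x.
  rewrite /A2 /B2 in_setI !in_setU in_setI in_setD.
  by case: (x \in S); case: (x \in U); case: (x \in sa); rewrite ?andbF.
have two (X Y1 Y2 : {set G}) : X \subset Y1 :|: Y2 -> #|Y1| <= p -> #|Y2| < p -> #|X| <= 2 * p.
  by move=> s l1 l2; rewrite mul2n -addnn; apply: card2 s l1 (ltnW l2).
have zA1 : #|Z :\: A1| < p.
  case: (unsplit sep1 o1) => // zB; exfalso.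
  have := freeP (fF h) (C := (S :&: V) :\: Z).
  have /andP[hV hZ] := freeV _ (fF h).
  rewrite !inE hS hV hZ setSD ?subsetIr // => /(_ isT isT); rewrite ltnNge.
  move=> /negP; apply; apply: two o1 zB; apply/subsetP => y /nbhP[yC [x]].
  rewrite in_setD in_setI => /and3P[xZ xS xV] xy; have /and3P[_ _ yV] := xy.
  move: yC; rewrite /A1 /B1 !in_setU !in_setI !in_setU !in_setD !in_setI yV !andbT.
  have [yS|yS] := boolP (y \in S) => /=; first by rewrite andbT negbK => ->; rewrite ?orbT.
  move=> _; rewrite andbT; have [//|yU] := boolP (y \in U).
  by have /andP[_ ->] := arcE x y xS yS yU xy.
have zB2 : #|Z :\: B2| < p.
  case: (unsplit sep2 o2) => // zA; exfalso.
  have := freeP wF (C := (V :\: (S :|: U)) :\: Z).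
  have /andP[wV wZ] := freeV _ wF.
  have wU : w \notin codom f by apply/negP => /codomP[h' E]; have := fw h'; rewrite E eqxx.
  rewrite !inE (negPf wS) (negPf wU) wV wZ setSD ?subsetDl // => /(_ isT isT); rewrite ltnNge.
  move=> /negP; apply; apply: two o2 zA; apply/subsetP => y /nbhP[yC [x]].
  rewrite 2!in_setD in_setU negb_or => /and3P[xZ /andP[xS xU] xV] xy.
  have /and3P[_ _ yV] := xy.
  move: yC; rewrite /A2 /B2 !in_setU !in_setI !in_setU !in_setD !in_setU !in_setI yV !andbT.
  have [yS|yS] := boolP (y \in S) => /=.
    have yx : induced y x by rewrite induced_sym.
    by move=> _; have /andP[-> _] := arcE y x yS xS xU yx.
  by have [yU|yU] //= := boolP (y \in U); rewrite andbT negbK => ->; rewrite ?orbT.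
have sZ : Z \subset ((Z :\: A1) :|: (Z :\: B2)) :|: ((ra :|: sa) :|: U).
  apply/subsetP => x xZ; rewrite /A1 /B2 !in_setU !in_setD !in_setU !in_setI xZ !andbT.
  rewrite !in_setD.
  by case: (x \in U); case: (x \in ra); case: (x \in sa); case: (x \in S);
     case: (x \in V); rewrite ?orbT.
have := leq_trans Z_big (subset_leq_card sZ).
have cardU (X Y : {set G}) : #|X :|: Y| <= #|X| + #|Y| by apply: leq_card_setU.
have l1 := cardU ((Z :\: A1) :|: (Z :\: B2)) ((ra :|: sa) :|: U).
have l2 := cardU (Z :\: A1) (Z :\: B2).
have l3 := cardU (ra :|: sa) U.
have l4 := cardU ra sa.
move: zA1 zB2 l1 l2 l3 l4 cU cra csa; rewrite /p; clearbody N; clear.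
by move: (N * N) => NN; lia.
Qed.

End Free.

(** * Graphs of bounded degree *)

(** A path is given by its two halves; equal colour words force equal lengths, so an empty [s1]
    means an empty path. *)
Definition nonrep_on (T : finType) (e : rel T) (U : {set T}) (C : eqType) (f : T -> C) :=
  forall s1 s2 : seq T, sorted e (s1 ++ s2) -> uniq (s1 ++ s2) ->
    all (mem U) (s1 ++ s2) -> map f s1 = map f s2 -> s1 = [::].

Definition colourable_on (T : finType) (e : rel T) (U : {set T}) (c : nat) :=
  exists f : T -> nat, (forall x, x \in U -> f x < c) /\ nonrep_on e U f.

(** An integer geometric series: the tail satisfies the same hypothesis with [K] halved. *)
Lemma sum_geometric_bound M (B : nat -> nat) K :
  (forall m, m < M -> 2 ^ m * B m <= K) -> \sum_(m < M) B m <= K.*2.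
Proof.
elim: M B K => [|M IHM] B K h; first by rewrite big_ord0.
rewrite big_ord_recl /= -addnn leq_add //; first by have := h 0; rewrite mul1n; exact.
apply: leq_trans (IHM (fun m => B m.+1) K./2 _) _.
  move=> m mM; have := h m.+1 mM; rewrite expnS -mulnA; lia.
by rewrite -[leqRHS]odd_double_half leq_addl.
Qed.

Lemma card_cover_seq (F : finType) (I : eqType) (r : seq I) (A : {set F})
    (B : I -> {set F}) :
  (forall x, x \in A -> exists2 i, i \in r & x \in B i) ->
  #|A| <= \sum_(i <- r) #|B i|.
Proof.
elim: r A => [|i r IHr] A h.
  by rewrite big_nil leqn0 cards_eq0; apply/eqP/setP => x; rewrite inE; apply/negP => /h[].
rewrite big_cons -(cardsID (B i) A) leq_add // ?subset_leq_card ?subsetIr //.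
apply: IHr => x; rewrite inE => /andP[xB /h[j]].
rewrite inE => /orP[/eqP ->|jr xj]; first by rewrite (negPf xB).
by exists j.
Qed.

Lemma map_eq_partner (T C : eqType) (s1 s2 : seq T) x :
  size s1 = size s2 -> x \in s1 ->
  exists2 y, y \in s2 & forall f : T -> C, map f s1 = map f s2 -> f x = f y.
Proof.
move=> sz xs; have ix : index x s1 < size s1 by rewrite index_mem.
exists (nth x s2 (index x s1)); first by rewrite mem_nth // -sz.
move=> f /(congr1 (fun s => nth (f x) s (index x s1))).
by rewrite !(nth_map x) -?sz // nth_index.
Qed.

Section BoundedDegree.
Variables (T : finType) (e : rel T) (U : {set T}) (D : nat).
Hypothesis e_sym : symmetric e.
Hypothesis D_gt0 : 0 < D.
Hypothesis degU : forall x, x \in U -> #|[set y in U | e x y]| <= D.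

Fixpoint walks n x : seq (seq T) :=
  if n is n'.+1 then
    flatten [seq [seq y :: p | p <- walks n' y] | y <- enum [set y in U | e x y]]
  else [:: [::]].

Lemma size_walks n x : x \in U -> size (walks n x) <= D ^ n.
Proof.
elim: n x => [|n IHn] x xU //=.
rewrite size_flatten /shape -map_comp sumnE big_map big_enum /= expnS.
apply: leq_trans (leq_mul (degU xU) (leqnn _)).
rewrite -sum_nat_const leq_sum // => y; rewrite inE => /andP[yU _].
by rewrite size_map IHn.
Qed.

Lemma mem_walks x p : path e x p -> all (mem U) p -> p \in walks (size p) x.
Proof.
elim: p x => [|y p IHp] x //= /andP[xy pth] /andP[yU pU].
apply/flattenP; exists [seq y :: p' | p' <- walks (size p) y].
  by apply/mapP; exists y; rewrite // mem_enum inE yU.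
by rewrite mem_map ?IHp // => p1 p2 [].
Qed.

Definition walks_through m v : seq (seq T) :=
  flatten [seq [seq rev l ++ v :: r | l <- walks i v, r <- walks (m.*2.-1 - i) v]
          | i <- iota 0 m.*2].

Lemma size_walks_through m v : v \in U ->
  size (walks_through m v) <= m.*2 * D ^ m.*2.-1.
Proof.
move=> vU; rewrite size_flatten /shape -map_comp sumnE big_map.
rewrite -[X in _ <= X * _](size_iota 0) -sum1_size big_distrl /=.
rewrite [leqLHS]big_seq [leqRHS]big_seq leq_sum // => i; rewrite mem_iota add0n => /andP[_ im].
rewrite size_allpairs mul1n (leq_trans (leq_mul (size_walks _ vU) (size_walks _ vU))) //.
by rewrite -expnD subnKC //; lia.
Qed.

Lemma mem_walks_through m v s : sorted e s -> all (mem U) s -> v \in s ->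
  size s = m.*2 -> s \in walks_through m v.
Proof.
move=> + + vs; case/splitPr: vs => l r srt aU sz.
rewrite all_cat /= in aU; case/and3P: aU => lU vU rU.
move: srt; rewrite sorted_cat_cons => /andP[srt pr].
have pl : path e v (rev l).
  by move: srt; rewrite -[rcons l v]revK rev_sorted rev_rcons /= (eq_path (e' := e)).
rewrite size_cat /= in sz.
apply/flattenP; exists [seq rev l' ++ v :: r' | l' <- walks (size l) v,
    r' <- walks (m.*2.-1 - size l) v].
  by apply/mapP; exists (size l) => //; rewrite mem_iota leq0n add0n -sz -addSnnS leq_addr.
apply/allpairsP; exists (rev l, r); split; last by rewrite /= revK.
  by rewrite /= -(size_rev l) mem_walks // all_rev.
by rewrite /= -sz addnS /= addKn mem_walks.
Qed.

(** The successor form provides [ord0] in ['I_c]. The summand [4 * D * D] is the growth factor to be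
    kept, and [4 * D] pays for the repetitive extensions. *)
Let c := (4 * D * D + 4 * D).-1.+1.
Let cE : c = 4 * D * D + 4 * D. Proof. by rewrite /c prednK //; nia. Qed.

Definition nonrepb (X : {set T}) (f : T -> 'I_c) : bool :=
  [forall m : 'I_#|T|.+1, forall s : (m.*2).-tuple T,
    ~~ [&& 0 < m, sorted e s, uniq s, all (mem X) s
         & map f (take m s) == map f (drop m s)]].

Lemma nonrepP X f : reflect (nonrep_on e X f) (nonrepb X f).
Proof.
apply: (iffP forallP) => [h s1 s2 srt u aX eqf|h m].
  have sz : size s1 = size s2 by rewrite -(size_map f) eqf size_map.
  have le : size s1 < #|T|.+1.
    have := max_card (mem (s1 ++ s2)); rewrite (card_uniqP u) size_cat; lia.
  have sz2 : size (s1 ++ s2) == (Ordinal le).*2 by rewrite size_cat -sz addnn.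
  have /forallP/(_ (Tuple sz2)) := h (Ordinal le).
  rewrite /= srt u aX take_size_cat // drop_size_cat // eqf eqxx !andbT -eqn0Ngt.
  by move/nilP.
apply/forallP => s; apply/negP => /and5P[m0 srt u aX /eqP eqf].
rewrite -[tval s](cat_take_drop m) in srt u aX.
have := h _ _ srt u aX eqf => /(congr1 size).
by rewrite size_take size_tuple; case: ltnP => _ /= /eqP; rewrite ?double_eq0 -leqn0 leqNgt m0.
Qed.

(** The default value [ord0] off [X] makes partial colourings of [X] countable as total functions
    without multiplicity. *)
Definition supp (X : {set T}) (f : {ffun T -> 'I_c}) := [forall x, (x \in X) || (f x == ord0)].

Definition cols X := [set f : {ffun T -> 'I_c} | supp X f && nonrepb X f].

Definition restr (X : {set T}) (f : {ffun T -> 'I_c}) : {ffun T -> 'I_c} :=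
  [ffun x => if x \in X then f x else ord0].

Lemma restr_cols (X Y : {set T}) (f : {ffun T -> 'I_c}) : Y \subset X -> nonrepb X f -> restr Y f \in cols Y.
Proof.
move=> sYX /nonrepP h; rewrite inE; apply/andP; split.
  by apply/forallP => x; rewrite ffunE; case: ifP => //=.
apply/nonrepP => s1 s2 srt u aY eqf; apply: h srt u _ _.
  by apply: sub_all aY => x; apply: (subsetP sYX).
move: aY eqf; rewrite all_cat => /andP[/allP a1 /allP a2].
have E s : {in s, forall x, x \in Y} -> map (restr Y f) s = map f s.
  by move=> a; apply/eq_in_map => x /a xY; rewrite ffunE xY.
by rewrite !E.
Qed.

Section Step.
Variables (X : {set T}) (v : T).
Hypotheses (sXU : X \subset U) (vX : v \in X).

Definition ext := [set f : {ffun T -> 'I_c} | supp X f && nonrepb (X :\ v) f].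
Definition bad m s := [set f in ext | [&& sorted e s, uniq s, all (mem X) s, v \in s, size s == m.*2
  & map f (take m s) == map f (drop m s)]].

Lemma card_extensions : c * #|cols (X :\ v)| <= #|ext|.
Proof.
pose F (q : 'I_c * {ffun T -> 'I_c}) : {ffun T -> 'I_c} :=
  [ffun x => if x == v then q.1 else q.2 x].
have Finj : {in setX [set: 'I_c] (cols (X :\ v)) &, injective F}.
  move=> [a f] [b g]; rewrite !inE /= => /andP[/forallP sf _] /andP[/forallP sg _] /ffunP E.
  have := E v; rewrite !ffunE eqxx /= => ->; congr (_, _); apply/ffunP => x.
  have := E x; rewrite !ffunE /=; case: eqVneq => // -> _.
  by have := sf v; have := sg v; rewrite !inE eqxx /= => /eqP -> /eqP ->.
have -> : c * #|cols (X :\ v)| = #|setX [set: 'I_c] (cols (X :\ v))|.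
  by rewrite cardsX cardsT card_ord.
rewrite -(card_in_imset Finj).
apply/subset_leq_card/subsetP => g /imsetP[[a f] +]; rewrite !inE /= => /andP[/forallP sf nf] ->.
apply/andP; split.
  apply/forallP => x; rewrite ffunE /=; case: (eqVneq x v) => [->|xv]; first by rewrite vX.
  by have := sf x; rewrite !inE xv.
apply/nonrepP => s1 s2 srt u aY eqf; move/nonrepP: nf => nf; apply: nf (srt) u (aY) _.
move: aY eqf; rewrite all_cat => /andP[/allP a1 /allP a2].
have E s : {in s, forall x, x \in X :\ v} -> map (F (a, f)) s = map f s.
  by move=> aa; apply/eq_in_map => x /aa; rewrite !inE ffunE => /andP[/negPf ->].
by rewrite !E.
Qed.

Lemma extensions_cover : #|ext| <= #|cols X| +
  \sum_(m < #|T|) \sum_(s <- walks_through m.+1 v) #|bad m.+1 s|.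
Proof.
rewrite -(cardsID (cols X) ext) leq_add ?subset_leq_card ?subsetIr //.
apply: leq_trans (_ : \sum_(m < #|T|)
   #|[set f in ext | has (fun s => f \in bad m.+1 s) (walks_through m.+1 v)]| <= _).
  apply: card_cover_seq => f; rewrite !inE => /andP[nf /andP[sf nv]].
  rewrite sf /= in nf.
  have : ~~ [forall m : 'I_#|T|.+1, forall s : (m.*2).-tuple T,
    ~~ [&& 0 < m, sorted e s, uniq s, all (mem X) s
         & map f (take m s) == map f (drop m s)]] by [].
  rewrite negb_forall => /existsP[m]; rewrite negb_forall => /existsP[s].
  rewrite negbK => /and5P[m0 srt u aX eqf].
  have vs : v \in (s : seq T).
    apply/negPn/negP => vs; move/nonrepP: nv => nv.
    rewrite -[tval s](cat_take_drop m) in srt u aX vs.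
    have sz : size (take m s) = m by rewrite size_takel // size_tuple -addnn leq_addr.
    suff /(congr1 size) : take m s = [::] by rewrite sz => h0; rewrite h0 in m0.
    apply: nv srt u _ (eqP eqf); apply/allP => x xs; rewrite !inE; have /= -> := allP aX x xs.
    by rewrite andbT; apply: contraNneq vs => <-.
  have ltm : m.-1 < #|T| by have := ltn_ord m; lia.
  exists (Ordinal ltm); first exact: mem_index_enum.
  rewrite !inE sf nv /= prednK //; apply/hasP; exists (tval s).
    apply: mem_walks_through => //; last by rewrite size_tuple.
    by apply: sub_all aX => x; apply: (subsetP sXU).
  by rewrite !inE sf nv srt u aX vs size_tuple eqxx eqf.
apply: leq_sum => m _; apply: card_cover_seq => f; rewrite inE => /andP[_ /hasP[s]].
by exists s.
Qed.

(** Let [h] be the half of [s] through [v]. Its colours are copied from the other half, so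
    restriction to [X :\: h] is injective on bad colourings; [hb] bounds the number of
    restrictions. *)
Lemma card_bad m s (b : nat) :
  (forall h : {set T}, h \subset X -> v \in h -> b ^ #|h|.-1 * #|cols (X :\: h)| <= #|cols (X :\ v)|) ->
  b ^ m.-1 * #|bad m s| <= #|cols (X :\ v)|.
Proof.
move=> hb; have [->|[f0]] := set_0Vmem (bad m s); first by rewrite cards0 muln0.
rewrite inE => /andP[_ /and5P[srt u aX vs /andP[/eqP sz _]]].
have sz1 : size (take m s) = m by rewrite size_takel // sz -addnn leq_addr.
have sz2 : size (drop m s) = m by rewrite size_drop sz -addnn addnK.
have vs' := vs; rewrite -(cat_take_drop m s) mem_cat in vs'.
have u' := u; rewrite -(cat_take_drop m s) cat_uniq in u'.
have [u1 /hasPn dj u2] := and3P u'.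
have [h1 [h2 [vh1 szh1 szh2 uh1 [hdj [hsub [hsub2 hE]]]]]] : exists h1 h2 : seq T,
   [/\ v \in h1, size h1 = m, size h2 = m, uniq h1
     & (forall x, x \in h2 -> x \notin h1) /\ {subset h1 <= s} /\ ({subset h2 <= s} /\
       forall f : T -> 'I_c, map f (take m s) = map f (drop m s) -> map f h1 = map f h2)].
  case/orP: vs' => vh; [exists (take m s), (drop m s) | exists (drop m s), (take m s)].
    by split=> //; split=> //; split; [exact: mem_take | split; [exact: mem_drop|]].
  split=> //; split; last by split; [exact: mem_drop|split; [exact: mem_take|]].
  by move=> x x1; apply/negP => /dj; rewrite /= x1.
pose h := [set x in h1].
have hX : h \subset X by apply/subsetP => x; rewrite inE => /hsub /(allP aX).
have ch : #|h| = m by rewrite /h cardsE (card_uniqP uh1).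
have vh : v \in h by rewrite inE.
apply: leq_trans (hb h hX vh); rewrite ch leq_mul2l; apply/orP; right.
have inj : {in bad m s &, injective (restr (X :\: h))}.
  move=> f g; rewrite !inE => /andP[/andP[/forallP sf _] /and5P[_ _ _ _ /andP[_ /eqP ef]]].
  move=> /andP[/andP[/forallP sg _] /and5P[_ _ _ _ /andP[_ /eqP eg]]] /ffunP E.
  have Eo x : x \in X -> x \notin h1 -> f x = g x.
    by move=> xX xh; have := E x; rewrite !ffunE !inE xX xh.
  apply/ffunP => x; have [xX|xX] := boolP (x \in X); last first.
    by have := sf x; have := sg x; rewrite (negPf xX) /= => /eqP -> /eqP ->.
  have [xh|] := boolP (x \in h1); last exact: Eo.
  have [y y2 yE] := @map_eq_partner _ 'I_c h1 h2 x (etrans szh1 (esym szh2)) xh.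
  rewrite (yE f) ?(yE g) ?hE //; apply: Eo; last exact: hdj.
  exact: (allP aX) (hsub2 _ y2).
rewrite -(card_in_imset inj); apply/subset_leq_card/subsetP => g /imsetP[f +].
rewrite !inE => /andP[/andP[_ nf] _] ->.
have: restr (X :\: h) f \in cols (X :\: h); last by rewrite inE.
apply: restr_cols nf; apply/subsetP => x; rewrite !inE => /andP[xh ->].
by rewrite andbT; apply: contraNneq xh => ->.
Qed.

End Step.

(* Rosenfeld's counting argument: a colouring that is repetitive on a path
   through [v] is determined by its values outside the half containing [v]. *)
Lemma cols_grow n (X : {set T}) v : #|X| <= n -> X \subset U -> v \in X ->
  4 * D * D * #|cols (X :\ v)| <= #|cols X|.
Proof.
elim: n X v => [|n IHn] X v; first by rewrite leqn0 cards_eq0 => /eqP ->; rewrite inE.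
move=> cX sXU vX; set b := 4 * D * D.
(* Deleting the vertices of [h] one at a time iterates the induction hypothesis. *)
have chain (Y h : {set T}) : #|Y| <= n -> Y \subset U -> h \subset Y ->
    b ^ #|h| * #|cols (Y :\: h)| <= #|cols Y|.
  move Ek: #|h| => k; elim: k h Ek Y => [|k IHk] h ch Y cY sYU hY.
    by rewrite expn0 mul1n; move/eqP: ch; rewrite cards_eq0 => /eqP ->; rewrite setD0.
  have [u uh] : exists u, u \in h by apply/set0Pn; rewrite -cards_eq0 ch.
  have uY := subsetP hY u uh.
  have ch' : #|h :\ u| = k by have := cardsD1 u h; rewrite uh ch; lia.
  have := IHk _ ch' (Y :\ u).
  have -> : (Y :\ u) :\: (h :\ u) = Y :\: h.
    by apply/setP => x; rewrite !inE; case: eqVneq => // ->; rewrite uh.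
  move=> IH; apply: leq_trans (IHn Y u cY sYU uY).
  rewrite expnS -mulnA leq_mul2l IH ?orbT //.
  - by have := cardsD1 u Y; rewrite uY; lia.
  - exact: subset_trans (subD1set _ _) sYU.
  - exact: setSD.
have hb (h : {set T}) : h \subset X -> v \in h ->
    b ^ #|h|.-1 * #|cols (X :\: h)| <= #|cols (X :\ v)|.
  move=> hX vh; have := chain (X :\ v) (h :\ v).
  have -> : (X :\ v) :\: (h :\ v) = X :\: h.
    by apply/setP => x; rewrite !inE; case: eqVneq => // ->; rewrite vh.
  have := cardsD1 v X; have := cardsD1 v h; rewrite vX vh => -> cX'; rewrite add1n /=; apply.
  - by lia.
  - exact: subset_trans (subD1set _ _) sXU.
  - exact: setSD.
have vU := subsetP sXU v vX.
have := leq_trans (card_extensions vX) (extensions_cover sXU vX).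
set N := #|cols (X :\ v)|.
have cN : c * N = b * N + 4 * D * N by rewrite -mulnDl -cE.
set Sg := (\sum_(m < _) _).
have: Sg <= (2 * D * N).*2; last by rewrite -addnn cN; lia.
apply: (@sum_geometric_bound _ (fun m => \sum_(s <- walks_through m.+1 v) #|bad X v m.+1 s|)) => m mT.
set Sm := (Y in _ * Y <= _).
(* The index [m] stands for half-length [m.+1]. As [b ^ m] is [4 ^ m * D ^ m.*2] and
   [m.+1.*2 <= 2 ^ m.+1], cancelling leaves [2 ^ m * Sm <= 2 * D * N], the geometric decay
   required. *)
have h1 : b ^ m * Sm <= m.+1.*2 * D ^ m.+1.*2.-1 * N.
  rewrite /Sm big_distrr /=.
  apply: leq_trans (_ : \sum_(s <- walks_through m.+1 v) N <= _).
    by apply: leq_sum => s _; apply: (card_bad m.+1 s hb).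
  by rewrite big_const_seq count_predT iter_addn_0 mulnC leq_mul2r size_walks_through ?orbT.
have h2 : m.+1.*2 <= 2 ^ m.+1 by rewrite -mul2n expnS leq_mul2l ltn_expl.
have DX : 0 < D ^ m.*2 by rewrite expn_gt0 D_gt0.
have e1 : b ^ m = 2 ^ m * 2 ^ m * D ^ m.*2.
  by rewrite /b (_ : 4 = 2 * 2) // !expnMn -addnn expnD mulnA.
have e2 : D ^ m.+1.*2.-1 = D * D ^ m.*2 by rewrite doubleS /= expnS.
move: h1 h2; rewrite e1 e2 expnS; move: (2 ^ m) (expn_gt0 2 m) (D ^ m.*2) DX => p p0 d d0.
move=> h1 h2; have {}h1 : p * p * Sm <= 2 * p * D * N.
  have h3 : m.+1.*2 * (D * d) * N <= 2 * p * (D * d) * N by rewrite !leq_mul.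
  by rewrite -(leq_pmul2r d0); move: (m.+1.*2) h1 h3 => ? ? ?; nia.
by rewrite -(leq_pmul2l p0); nia.
Qed.

Lemma bounded_degree_colourable : colourable_on e U (4 * D * D + 4 * D).
Proof.
have pos n (X : {set T}) : #|X| <= n -> X \subset U -> 0 < #|cols X|.
  elim: n X => [|n IHn] X cX sXU.
    move: cX; rewrite leqn0 cards_eq0 => /eqP ->; apply/card_gt0P.
    exists [ffun=> ord0]; rewrite inE; apply/andP; split.
      by apply/forallP => x; rewrite ffunE eqxx orbT.
    by apply/nonrepP => [[|x s1]] s2 //= _ _; rewrite inE.
  have [->|[v vX]] := set_0Vmem X; first by apply: IHn; rewrite ?cards0 ?sub0set.
  apply: leq_trans (cols_grow cX sXU vX); rewrite muln_gt0; apply/andP; split; first by nia.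
  apply: IHn; first by have := cardsD1 v X; rewrite vX; lia.
  exact: subset_trans (subD1set _ _) sXU.
have /card_gt0P[f] := pos _ U (leqnn _) (subxx _).
rewrite inE => /andP[_ /nonrepP nf]; exists (fun x => val (f x)); split=> [x _|].
  by rewrite -cE; exact: ltn_ord.
move=> s1 s2 srt u aU eqf; apply: nf srt u aU _.
by apply: (inj_map val_inj); rewrite -!map_comp.
Qed.

End BoundedDegree.

(** * Square-free words and lazy walks *)

Definition squarefree n (h : nat -> nat) := forall a d, 0 < d -> a + d + d <= n ->
  ~ (forall i, i < d -> h (a + i) = h (a + d + i)).

(** A square-free word is a nonrepetitive colouring of a path, which has degree at most 2; [24] is
    [4 * 2 * 2 + 4 * 2]. *)
Lemma squarefree_exists n : exists2 h : nat -> nat, (forall i, h i < 24) & squarefree n h.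
Proof.
case: n => [|n].
  exists (fun=> 0) => // a d d0; rewrite leqn0 !addn_eq0 => /andP[_ /eqP dz].
  by rewrite dz in d0.
pose e (i j : 'I_n.+1) := (i.+1 == j :> nat) || (j.+1 == i :> nat).
have e_sym : symmetric e by move=> i j; rewrite /e orbC.
have deg (i : 'I_n.+1) : i \in [set: 'I_n.+1] -> #|[set j in [set: 'I_n.+1] | e i j]| <= 2.
  move=> _; pose S m := [set j : 'I_n.+1 | j == m :> nat].
  have S1 m : #|S m| <= 1.
    by apply/card_le1_eqP => x y; rewrite !inE => /eqP xm /eqP ym; apply: val_inj; rewrite /= xm ym.
  apply: leq_trans (_ : #|S i.+1 :|: S i.-1| <= _).
    apply/subset_leq_card/subsetP => j; rewrite !inE /e => /orP[/eqP <-|/eqP <-] /=.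
      by rewrite eqxx.
    by rewrite eqxx orbT.
  apply: leq_trans (leq_card_setU _ _) _; exact: (leq_add (S1 _) (S1 _)).
have [f [fb fn]] := bounded_degree_colourable e_sym (isT : 0 < 2) deg.
exists (fun i => f (inord i)) => [i|a d d0 ad rep]; first by apply: fb; rewrite inE.
have srt m b : b + m <= n.+1 -> sorted e (map inord (iota b m)).
  elim: m b => [|[|m] IHm] b bm //=; have := IHm b.+1; rewrite /= addSnnS => -> //.
  by rewrite andbT /e !inordK ?eqxx //; move: bm; clear; lia.
have cat : map inord (iota a d) ++ map inord (iota (a + d) d) = map (@inord n) (iota a (d + d)).
  by rewrite iotaD map_cat.
suff /(congr1 size) : [seq (@inord n) i | i <- iota a d] = [::].
  by rewrite size_map size_iota => dz; rewrite dz in d0.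
apply: (fn _ (map inord (iota (a + d) d))).
- by rewrite cat; apply: srt; rewrite addnA.
- rewrite cat map_inj_in_uniq ?iota_uniq // => i j; rewrite !mem_iota => hi hj.
  move/(congr1 val); rewrite /= !inordK //; move: hi hj ad; clear; lia.
- by apply/allP => x _; rewrite /= inE.
have E b : iota b d = map (addn b) (iota 0 d) by rewrite -iotaDl addn0.
by rewrite (E a) (E (a + d)) -!map_comp; apply/eq_in_map => i; rewrite mem_iota => /rep.
Qed.

Lemma discrete_ivt_up (F : nat -> nat) m v :
  (forall i, i < m -> F i.+1 <= (F i).+1) -> F 0 <= v <= F m ->
  exists2 i, i <= m & F i = v.
Proof.
elim: m => [|m IHm] st /andP[lo hi]; first by exists 0 => //; lia.
have [->|ne] := eqVneq v (F m.+1); first by exists m.+1.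
have [|i im Fi] := IHm (fun i im => st i (leqW im)); last by exists i; rewrite 1?leqW.
by rewrite lo; have := st m (leqnn _); lia.
Qed.

Lemma discrete_ivt_down (F : nat -> nat) m v :
  (forall i, i < m -> F i <= (F i.+1).+1) -> F m <= v <= F 0 ->
  exists2 i, i <= m & F i = v.
Proof.
elim: m => [|m IHm] st /andP[lo hi]; first by exists 0 => //; lia.
have [->|ne] := eqVneq v (F m.+1); first by exists m.+1.
have [|i im Fi] := IHm (fun i im => st i (leqW im)); last by exists i; rewrite 1?leqW.
by rewrite hi; have := st m (leqnn _); lia.
Qed.

(* Residues modulo 3 determine the steps of a lazy walk, so the two halves of a
   repetitively labelled walk are translates of each other; a nonzero shift
   would exhibit a square in [h]. *)
Lemma lazy_walk_halves (F h : nat -> nat) m n :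
  (forall i, i.+1 < m + m -> F i <= (F i.+1).+1 /\ F i.+1 <= (F i).+1) ->
  (forall i, i < m + m -> F i < n) -> squarefree n h ->
  (forall i, i < m -> F i %% 3 = F (m + i) %% 3) ->
  (forall i, i < m -> h (F i) = h (F (m + i))) ->
  forall i, i < m -> F i = F (m + i).
Proof.
move=> st bd sq m3 mh.
case: m => [|m] // in st bd m3 mh *.
have stm : F m <= (F m.+1).+1 /\ F m.+1 <= (F m).+1 by apply: st; lia.
have [le|lt] := leqP (F 0) (F m.+1).
  pose d := F m.+1 - F 0.
  (* Corresponding increments lie between -1 and 1 and agree modulo 3, so they are equal. *)
  have tr i : i < m.+1 -> F (m.+1 + i) = F i + d.
    elim: i => [|i IHi] im; first by rewrite addn0 /d; lia.
    have {}IHi := IHi (ltnW im).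
    have := st i; have := st (m.+1 + i); have := m3 _ im; have := m3 _ (ltnW im).
    by rewrite -addnS IHi; lia.
  have [dz|dp] := posnP d; first by move=> i im; rewrite tr // dz addn0.
  (* Climbing by at most one per step, [F] takes each value [F 0 + j] with [j < d] in the first
     half, and [F 0 + j + d] at the matching place in the second. This is a square of period [d] at
     [F 0]. *)
  exfalso; apply: (sq (F 0) d dp).
    have [i im Fi] : exists2 i, i <= m & F i = F 0 + d.-1.
      apply: discrete_ivt_up => [i im|]; last by rewrite /d; lia.
      by have := st i; lia.
    have := bd (m.+1 + i); rewrite tr // Fi; lia.
  move=> j jd; have [i im Fi] : exists2 i, i <= m & F i = F 0 + j.
    apply: discrete_ivt_up => [i im|]; last by move: jd; rewrite /d; lia.
    by have := st i; lia.
  by rewrite -Fi mh // tr // Fi addnAC.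
pose d := F 0 - F m.+1.
have tr i : i < m.+1 -> F i = F (m.+1 + i) + d.
  elim: i => [|i IHi] im; first by rewrite addn0 /d; lia.
  have {}IHi := IHi (ltnW im).
  have := st i; have := st (m.+1 + i); have := m3 _ im; have := m3 _ (ltnW im).
  by rewrite -addnS; lia.
have dp : 0 < d by rewrite /d; lia.
have hit j : j < d -> exists2 i, i <= m & F i = F 0 - j.
  move=> jd; apply: discrete_ivt_down => [i im|]; last by move: jd; rewrite /d; lia.
  by have := st i; lia.
have bot : d + d.-1 <= F 0.
  have [|i im Fi] := hit d.-1; first by lia.
  by have := tr i im; lia.
(* In the descending case the square ends at position [F 0]; its upper block consists of values
   taken in the first half. *)
exfalso; apply: (sq (F 0 - d - d.-1) d dp); first by have := bd 0; lia.
move=> j jd; have [|i im Fi] := hit (d.-1 - j); first by lia.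
have := mh i im; have := tr i im; rewrite Fi => e1 e2.
have -> : F 0 - d - d.-1 + d + j = F 0 - (d.-1 - j) by lia.
by rewrite e2; congr h; lia.
Qed.

(** * Glueing along cliques and layerings *)

Definition clique (T : finType) (e : rel T) (A : {set T}) :=
  forall x y, x \in A -> y \in A -> x != y -> e x y.

(* Plays the role of a tree decomposition of adhesion at most [k] with good
   torsos, started from [U0]. *)
Inductive grow (T : finType) (k : nat) (e : rel T) (good : {set T} -> Prop)
    (U0 : {set T}) : {set T} -> Prop :=
| GrowRefl : grow k e good U0 U0
| GrowGlue U B : grow k e good U0 U -> good B -> #|U :&: B| <= k ->
    clique e (U :&: B) ->
    (forall x y, x \in U -> x \notin B -> y \in B -> y \notin U -> ~~ e x y) ->
    grow k e good U0 (U :|: B).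

Lemma colourable_onS (T : finType) (e : rel T) (c : nat) (A B : {set T}) :
  B \subset A -> colourable_on e A c -> colourable_on e B c.
Proof.
move=> sBA [f [fb fn]]; exists f; split=> [x xB|s1 s2 srt u aB].
  by apply: fb; apply: (subsetP sBA).
by apply: fn => //; apply: sub_all aB => x; apply: (subsetP sBA).
Qed.

Section Layering.
Variables (T : finType) (e : rel T) (c : nat).
Hypothesis e_sym : symmetric e.
Notation good := (fun B => colourable_on e B c).

Definition layer (l : T -> nat) (U : {set T}) i := [set x in U | l x == i].

(** Walk form of the condition that a component of the layers above a given one has a clique as its
    neighbourhood in that layer. *)
Definition shadow_complete (l : T -> nat) (U : {set T}) := forall x y s,
  x \in U -> y \in U -> l x = l y -> x != y ->
  all (fun z => (z \in U) && (l x < l z)) s -> path e x (rcons s y) -> e x y.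

(** All of [B] has level at most [j.+1]. From a new vertex, every neighbour is in [B], so no walk
    can rise above it and only a single edge remains; from an old vertex, detours through [B] are
    shortcut inside the clique. *)
Lemma shadow_complete_glue l (U B : {set T}) j :
  shadow_complete l U -> clique e (U :&: B) ->
  (forall x y, x \in U -> x \notin B -> y \in B -> y \notin U -> ~~ e x y) ->
  (forall x, x \in U :&: B -> l x <= j.+1) ->
  shadow_complete (fun x => if x \in U then l x else j.+1) (U :|: B).
Proof.
move=> sh cl noe lj; set l' := fun x => _.
have lB z : z \in B -> l' z <= j.+1.
  by move=> zB; rewrite /l'; case: ifP => // zU; apply: lj; rewrite inE zU.
have toB z y : z \in U :|: B -> y \in B -> y \notin U -> e z y -> z \in B.
  move=> zU yB yU zy; case/setUP: zU => // zU; apply/negPn/negP => zB.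
  by have := noe z y zU zB yB yU; rewrite zy.
have newB z : z \in U :|: B -> z \notin U -> z \in B by rewrite inE => /orP[->|].
move=> x y s xUB yUB lxy nxy al pth.
have [xU|xU] := boolP (x \in U); last first.
  case: s al pth => [|z s] /=; first by rewrite andbT.
  case/andP=> /andP[zU lz] _ /andP[xz _].
  have zB : z \in B by apply: (toB z x) => //; [apply: newB | rewrite e_sym].
  have := lB z zB; rewrite leqNgt; have -> : j.+1 < l' z => //.
  by apply: leq_ltn_trans lz; rewrite /l' (negPf xU).
have lx : l' x = l x by rewrite /l' xU.
pose reach z := exists t, [/\ all (fun z => (z \in U) && (l x < l z)) t, path e x t & last x t = z].
(* Every detour through the new bag starts and ends in the clique, hence can be
   replaced by an edge. *)
have inv t : all (fun z => (z \in U :|: B) && (l' x < l' z)) t -> path e x t ->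
    if last x t \in U then reach (last x t) else exists2 a, a \in U :&: B & reach a.
  elim/last_ind: t => [|t z IHt]; first by rewrite /= xU => _ _; exists [::].
  rewrite all_rcons rcons_path last_rcons => /andP[/andP[zUB lz] at'] /andP[pt ez].
  have {}IHt := IHt at' pt.
  have step a : reach a -> z \in U -> e a z -> reach z.
    move=> [t1 [a1 p1 l1]] zU az; exists (rcons t1 z); split.
    - by rewrite all_rcons a1 zU andbT /=; move: lz; rewrite lx /l' zU.
    - by rewrite rcons_path p1 l1.
    - by rewrite last_rcons.
  have lUB : last x t \in U :|: B.
    case/lastP: t at' {pt ez IHt} => [|t z'] /=; first by rewrite inE xU.
    by rewrite all_rcons last_rcons => /andP[/andP[]].
  case: ifP IHt => lU; case: ifP => zU.
  - by move=> r; apply: step r zU ez.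
  - move=> r; exists (last x t) => //; rewrite inE lU.
    by apply: (toB _ z) => //; rewrite ?zU ?newB ?zU.
  - move=> [a aA ra].
    have zB : z \in B.
      apply: (toB z (last x t)) => //; rewrite ?lU //; first by apply: newB; rewrite ?lU.
      by rewrite e_sym.
    have [E|ne] := eqVneq a z; first by rewrite -E.
    by apply: (step a) => //; apply: cl => //; rewrite inE zU.
  - by move=> [a aA ra]; exists a.
move: pth; rewrite rcons_path => /andP[ps ey].
have := inv s al ps.
have lUB : last x s \in U :|: B.
  case/lastP: s al {ps ey} => [|t z'] /=; first by rewrite inE xU.
  by rewrite all_rcons last_rcons => /andP[/andP[]].
have [yU|yU] := boolP (y \in U); last first.
  have zB := toB _ y lUB (newB _ yUB yU) yU ey.
  case/lastP: s al ey {ps lUB} zB => [|t z] //=.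
  rewrite all_rcons last_rcons => /andP[/andP[_ lz] _] _ /lB.
  by move: lz; rewrite lxy {1}/l' (negPf yU) => lz; rewrite leqNgt lz.
have fin a : reach a -> e a y -> e x y.
  move=> [t [at' pt lt]] ay; apply: (sh x y t) => //; last by rewrite rcons_path pt lt.
  by move: lxy; rewrite /l' xU yU.
case: ifP => lU; first by move=> r; apply: fin r ey.
move=> [a aA ra]; apply: (fin a) => //; apply: cl => //.
  by rewrite inE yU; apply: (toB y (last x s)); rewrite ?lU //; [apply: newB; rewrite ?lU | rewrite e_sym].
case: ra => t [at' _ <-]; case/lastP: t at' => [|t z] //=.
rewrite all_rcons last_rcons => /andP[/andP[_ lz] _].
by apply: contraTneq lz => ->; move: lxy; rewrite /l' xU yU => ->; rewrite ltnn.
Qed.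

(** The clique [U :&: B] spans at most the levels [j] and [j.+1], [j] being its minimum; the new
    vertices go to level [j.+1]. There the new bag meets the old layer in the clique without its
    vertices of level [j], so the adhesion drops. *)
Lemma layering k U : grow k.+1 e good set0 U -> exists l : T -> nat,
  [/\ forall x y, x \in U -> y \in U -> e x y -> l x <= (l y).+1,
      forall i, grow k e good set0 (layer l U i)
    & shadow_complete l U].
Proof.
elim=> {U} [|U B gU [l [l1 l2 l3]] goodB cA cl noe].
  exists (fun=> 0); split=> [x y|i|x y s]; rewrite ?inE //.
  have -> : layer (fun=> 0) set0 i = set0 by apply/setP => x; rewrite !inE.
  exact: GrowRefl.
have [j [jlo [jmem jhi]]] : exists j, (forall x, x \in U :&: B -> j <= l x) /\
    ((U :&: B != set0 -> exists2 x, x \in U :&: B & l x = j) /\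
     (forall x, x \in U :&: B -> l x <= j.+1)).
  have [->|[a aA]] := set_0Vmem (U :&: B).
    by exists 0; split=> [x|]; [rewrite inE | split=> [|x]; rewrite ?eqxx ?inE].
  case: (arg_minnP l aA) => b bA bmin; exists (l b); split=> //; split=> [_|x xA].
    by exists b.
  have [->|ne] := eqVneq x b; first exact: leqnSn.
  by apply: l1; [have /setIP[] := xA | have /setIP[] := bA | apply: cl].
pose l' x := if x \in U then l x else j.+1.
have lB z : z \in B -> l' z = j.+1 \/ (z \in U :&: B /\ l' z = l z).
  by move=> zB; rewrite /l' inE zB andbT; case: ifP => zU; [right | left].
have newB z : z \in U :|: B -> z \notin U -> z \in B by rewrite inE => /orP[->|].
exists l'; split=> [x y xUB yUB exy|i|]; last exact: shadow_complete_glue.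
- have [xU|xU] := boolP (x \in U); have [yU|yU] := boolP (y \in U); rewrite /l'.
  + by rewrite xU yU; apply: l1.
  + rewrite xU (negPf yU) leqW // jhi // inE xU; apply/negPn/negP => xB.
    by have := noe x y xU xB (newB _ yUB yU) yU; rewrite exy.
  + rewrite (negPf xU) yU ltnS jlo // inE yU; apply/negPn/negP => yB.
    by have := noe y x yU yB (newB _ xUB xU) xU; rewrite e_sym exy.
  + by rewrite (negPf xU) (negPf yU).
have [ij|nij] := eqVneq i j.+1; last first.
  suff -> : layer l' (U :|: B) i = layer l U i by [].
  apply/setP => x; rewrite !inE /l'; case: ifP => //= _.
  by rewrite eq_sym (negPf nij) andbF.
pose Bi := [set x in B | l' x == i].
have -> : layer l' (U :|: B) i = layer l U i :|: Bi.
  apply/setP => x; rewrite !inE /l'; case: ifP => //=.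
  by case: (l x == i); rewrite ?andbF ?andbT.
have sA : layer l U i :&: Bi \subset U :&: B.
  by apply/subsetP => x; rewrite !inE => /andP[/andP[-> _] /andP[-> _]].
apply: GrowGlue => //.
- by apply: colourable_onS goodB; apply/subsetP => x; rewrite inE => /andP[].
- rewrite -ltnS; have [E|ne] := eqVneq (U :&: B) set0.
    by move: sA; rewrite E subset0 => /eqP ->; rewrite cards0.
  have [b bA lb] := jmem ne; apply: leq_trans cA; apply: proper_card.
  apply/properP; split=> //; exists b => //; rewrite !inE lb ij.
  by apply/negP => /andP[/andP[_ /eqP h] _]; move: h; clear; lia.
- by move=> x y xA yA; apply: cl; apply: (subsetP sA).
- move=> x y; rewrite !inE => /andP[xU /eqP lx] xB /andP[yB /eqP ly] yU.
  apply: noe => //; first by apply: contraNN xB => ->; rewrite /l' xU lx eqxx.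
  by apply: contraNN yU => yU; rewrite yU /=; move: ly; rewrite /l' yU => ->.
Qed.

(** The list [t] accumulates the excursion above level [i] since the last visit [x];
    shadow-completeness replaces it by an edge on return. *)
Lemma filter_min_layer_path l U i x t p : shadow_complete l U -> l x = i ->
  all (mem U) (x :: t ++ p) -> all (fun z => i < l z) t -> all (fun z => i <= l z) p ->
  uniq (x :: t ++ p) -> path e x (t ++ p) -> path e x [seq z <- p | l z == i].
Proof.
move=> sh; elim: p x t => [|y p IHp] x t // lx aU at' ap u pth.
have /and3P[xU tU /andP[yU pU]] : [&& x \in U, all (mem U) t & (y \in U) && all (mem U) p].
  by move: aU; rewrite /= all_cat.
case/andP: ap => /= ly ap.
have pth' : path e x (rcons t y ++ p) by rewrite cat_rcons.
case: eqP => [ly'|/eqP ly'] /=.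
  have xy : x != y.
    by apply: contraTneq u => ->; rewrite /= mem_cat inE eqxx orbT.
  have -> /= : e x y.
    apply: (sh x y t) => //; first by rewrite lx.
      apply/allP => z zt; have /= -> := allP tU _ zt; rewrite lx; exact: allP at' _ zt.
    by move: pth'; rewrite cat_path => /andP[].
  apply: (IHp y [::]) => //=; first by rewrite yU.
    by move: u => /= /andP[_]; rewrite cat_uniq => /and3P[_ _].
  by move: pth'; rewrite cat_path last_rcons => /andP[].
apply: (IHp x (rcons t y)) => //; rewrite ?cat_rcons //.
by rewrite all_rcons at' andbT ltn_neqAle eq_sym ly'.
Qed.

Lemma filter_min_layer_sorted l U i s : shadow_complete l U ->
  all (mem U) s -> all (fun z => i <= l z) s -> uniq s -> sorted e s ->
  sorted e [seq z <- s | l z == i].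
Proof.
move=> sh; elim: s => [|x s IHs] //= /andP[xU sU] /andP[lx ls] /andP[xs us] pth.
case: eqP => [lxi|_] /=; last by apply: IHs => //; apply: path_sorted pth.
by apply: (@filter_min_layer_path l U i x [::] s) => //=; rewrite ?xU ?sU ?xs ?us.
Qed.

Lemma finite_choice (A : Type) (a0 : A) n (P : nat -> A -> Prop) :
  (forall i, exists a, P i a) -> exists f : nat -> A, forall i, i < n -> P i (f i).
Proof.
move=> h; elim: n => [|n [f fP]]; first by exists (fun=> a0).
have [a aP] := h n; exists (fun i => if i == n then a else f i) => i.
rewrite ltnS leq_eqVlt; case: eqP => [->|_] //=; exact: fP.
Qed.

(** The colour packs a square-free letter, a residue modulo 3 and a colour within the layer. On a
    repetitive path the first two make the layers of both halves agree; then the vertices on the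
    lowest layer form a path whose halves are coloured alike by [psi]. *)
Lemma colour_layering c1 l (U : {set T}) :
  (forall x y, x \in U -> y \in U -> e x y -> l x <= (l y).+1) ->
  (forall i, colourable_on e (layer l U i) c1) -> shadow_complete l U ->
  colourable_on e U (24 * 3 * c1).
Proof.
move=> l1 l2 sh.
pose n := (\max_x l x).+1.
have ln x : l x < n by rewrite ltnS; apply: leq_bigmax.
have [h hb hs] := squarefree_exists n.
have [psi psiP] := finite_choice (fun=> 0) n l2.
pose pk x := h (l x) * 3 + l x %% 3.
pose col x := pk x * c1 + psi (l x) x.
have psib x : x \in U -> psi (l x) x < c1.
  by move=> xU; have [b _] := psiP _ (ln x); apply: b; rewrite inE xU eqxx.
have pkb x : pk x < 24 * 3.
  by rewrite /pk; have := hb (l x); have := ltn_pmod (l x) (isT : 0 < 3); lia.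
exists col; split=> [x xU|s1 s2 srt u aU eqc].
  have := psib x xU; have := pkb x; rewrite /col; move: (pk x) (psi _ x) => a b.
  by nia.
have colE x y : x \in U -> y \in U -> col x = col y ->
    [/\ h (l x) = h (l y), l x %% 3 = l y %% 3 & psi (l x) x = psi (l y) y].
  move=> xU yU E; have bx := psib x xU; have by' := psib y yU.
  have c1p : 0 < c1 by apply: leq_ltn_trans bx.
  have pE : pk x = pk y.
    by have := congr1 (divn^~ c1) E; rewrite /col !divnMDl // !divn_small // !addn0.
  split.
  - have := congr1 (divn^~ 3) pE; rewrite /pk !divnMDl // !divn_small ?ltn_pmod //.
    by rewrite !addn0.
  - by have := congr1 (modn^~ 3) pE; rewrite /pk !modnMDl !modn_mod.
  - by move: E; rewrite /col pE => /addnI.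
have sz : size s1 = size s2 by rewrite -(size_map col) eqc size_map.
have [//|s1n] := eqVneq s1 [::].
have x0 : T by case: (s1) s1n.
pose m := size s1.
have aU1 i : i < m -> nth x0 s1 i \in U.
  by move=> im; apply: (allP aU); rewrite mem_cat mem_nth.
have aU2 i : i < m -> nth x0 s2 i \in U.
  by move=> im; apply: (allP aU); rewrite mem_cat mem_nth ?orbT // -sz.
have nE i : i < m -> [/\ h (l (nth x0 s1 i)) = h (l (nth x0 s2 i)),
    l (nth x0 s1 i) %% 3 = l (nth x0 s2 i) %% 3
  & psi (l (nth x0 s1 i)) (nth x0 s1 i) = psi (l (nth x0 s2 i)) (nth x0 s2 i)].
  move=> im; apply: colE; rewrite ?aU1 ?aU2 //.
  have := congr1 (fun s => nth (col x0) s i) eqc.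
  by rewrite !(nth_map x0) // -sz.
pose F i := l (nth x0 (s1 ++ s2) i).
have F1 i : i < m -> F i = l (nth x0 s1 i) by move=> im; rewrite /F nth_cat im.
have F2 i : i < m -> F (m + i) = l (nth x0 s2 i).
  by move=> im; rewrite /F nth_cat ltnNge leq_addr addKn.
have lE i : i < m -> l (nth x0 s1 i) = l (nth x0 s2 i).
  move=> im; rewrite -F1 // -F2 //.
  apply: (@lazy_walk_halves F h m n) (im) => // {im}i im.
  - have im' : i.+1 < size (s1 ++ s2) by rewrite size_cat -sz.
    have /(_ _ im') ee := (sortedP x0 srt).
    have [iU iU'] : nth x0 (s1 ++ s2) i \in U /\ nth x0 (s1 ++ s2) i.+1 \in U.
      by split; apply: (allP aU); apply: mem_nth => //; apply: ltnW.
    by split; apply: l1; rewrite // e_sym.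
  - exact: ln.
  - by rewrite F1 // F2 //; have [] := nE i im.
  - by rewrite F1 // F2 //; have [] := nE i im.
have mapE : map (fun x => (l x, psi (l x) x)) s1 = map (fun x => (l x, psi (l x) x)) s2.
  apply: (@eq_from_nth _ (0, 0)); rewrite ?size_map // => i im.
  rewrite !(nth_map x0) -?sz //; have [_ _ ->] := nE i im.
  by rewrite lE.
have [x1 x1s] : exists x, x \in s1 ++ s2.
  by exists (head x0 s1); rewrite mem_cat; case: (s1) s1n => // ? ? _; rewrite inE eqxx.
case: (arg_minnP (P := mem (s1 ++ s2)) l x1s) => z zs zmin.
pose i := l z.
have mins : all (fun x => i <= l x) (s1 ++ s2) by apply/allP => x xs; apply: zmin.
have [_ nr] := psiP _ (ln z).
have := filter_min_layer_sorted sh aU mins u srt; rewrite filter_cat => srt'.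
have emp : [seq x <- s1 | l x == i] = [::].
  apply: (nr _ [seq x <- s2 | l x == i]) => //.
  - by rewrite -filter_cat filter_uniq.
  - rewrite -filter_cat; apply/allP => x; rewrite mem_filter => /andP[lx xs].
    by rewrite /= inE lx andbT; exact: allP aU _ xs.
  have E s : map (psi i) [seq x <- s | l x == i] =
      map snd [seq q <- map (fun x => (l x, psi (l x) x)) s | q.1 == i].
    rewrite filter_map -map_comp; apply/eq_in_map => x.
    by rewrite mem_filter => /andP[/= /eqP ->].
  by rewrite !E mapE.
have has1 : has (fun x => l x == i) s1.
  have : has (fun q => q.1 == i) (map (fun x => (l x, psi (l x) x)) s1).
    move: zs; rewrite /= mem_cat => /orP[zs|zs]; first by apply/hasP; exists (l z, psi (l z) z);
      rewrite ?map_f //= eqxx.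
    by rewrite mapE; apply/hasP; exists (l z, psi (l z) z); rewrite ?map_f //= eqxx.
  by rewrite has_map.
by move: has1; rewrite has_filter emp.
Qed.

(** Each layering lowers the adhesion by one at the cost of a factor [24 * 3]. At adhesion 0 the
    bags are disjoint with no edges between them, so a path stays in one bag. *)
Theorem grow_colourable k U : grow k e good set0 U ->
  colourable_on e U (c * (24 * 3) ^ k).
Proof.
elim: k U => [|k IHk] U gU; last first.
  have [l [l1 l2 l3]] := layering gU.
  rewrite expnS mulnCA -[_ * (c * _)]/(24 * 3 * _).
  by apply: colour_layering l3 => // i; apply: IHk.
rewrite expn0 muln1; elim: gU => {U} [|U B gU [f [fb fn]] [f' [fb' fn']] c0 _ noe].
  by exists (fun=> 0); split=> [x|[|x s1] s2 //= _ _]; rewrite inE.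
move: c0; rewrite leqn0 cards_eq0 => /eqP dj.
have UB x : x \in U -> x \notin B.
  by move=> xU; apply/negP => xB; have := in_set0 x; rewrite -dj inE xU xB.
exists (fun x => if x \in U then f x else f' x); split=> [x|s1 s2 srt u aUB].
  by rewrite inE; case: ifP => [xU _|_ xB]; [apply: fb | apply: fb'].
have side s : sorted e s -> all (mem (U :|: B)) s -> all (mem U) s \/ all (mem B) s.
  case: s => [|x s] /=; first by left.
  elim: s x => [|y s IHs] x /=.
    by rewrite inE => _ /andP[/orP[->|->] _]; [left|right].
  move=> /andP[xy ps] /andP[xUB /andP[yUB aU]].
  have := IHs y ps; rewrite yUB aU => /(_ isT) [] /andP[yS ->]; rewrite yS ?andbT /=.
    left; rewrite ?andbT; apply/negPn/negP => xU.
    move: xUB; rewrite inE (negPf xU) /= => xB.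
    by have := noe y x yS (UB _ yS) xB xU; rewrite e_sym xy.
  right; rewrite ?andbT; move: xUB; rewrite inE => /orP[xU|//].
  have yU : y \notin U by apply: contraL yS; apply: UB.
  by have := noe x y xU (UB _ xU) yS yU; rewrite xy.
have E1 s : all (mem U) s -> map (fun x => if x \in U then f x else f' x) s = map f s.
  by move=> /allP h; apply/eq_in_map => x /h /= ->.
have E2 s : all (mem B) s -> map (fun x => if x \in U then f x else f' x) s = map f' s.
  by move=> /allP h; apply/eq_in_map => x /h /= xB; rewrite ifN //; apply: contraL xB; apply: UB.
case: (side _ srt aUB) => aS; have := aS; rewrite all_cat => /andP[h1 h2].
  by rewrite !E1 //; apply: fn.
by rewrite !E2 //; apply: fn'.
Qed.

End Layering.

(** * Torsos and the decomposition *)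

Section Torso.
Variables (T : finType) (g : rel T) (V Z : {set T}) (k : nat).
Hypotheses (g_sym : symmetric g) (gV : forall x y, g x y -> y \in V).

(** The forbidden set [Z :|: ~: V] keeps these sets inside [V] and off [Z]. *)
Let Mx C := maxset (adm g (Z :|: ~: V) k) C.

Definition inner := [set x | [exists C : {set T}, Mx C && (x \in C)] &&
  [forall C : {set T}, Mx C ==> (x \notin nbh g C)]].

Definition torso_bag := V :\: inner.

Let near C := [set C' : {set T} | Mx C' && ~~ [disjoint C' & nbh g C]].

(** Designed to contain all torso neighbours of the bag vertices in [C] and the attachments of all
    deleted components inside [C]. *)
Definition boundary C := nbh g C :|: \bigcup_(C' in near C) nbh g C'.

(** There are [k] neighbours of [C], each in at most [4 ^ k] maximal sets, each of which has at most
    [k] neighbours. *)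
Definition torso_bound := k + k * 4 ^ k * k.

Lemma maxadmP C : Mx C -> [/\ C != set0, conn g C, C \subset V :\: Z & #|nbh g C| <= k].
Proof.
move=> /maxsetP[/and4P[h1 h2 h3 h4] _]; split=> //.
by rewrite disjoints_subset setCU setCK setIC -setDE in h3.
Qed.

Lemma card_boundary C : Mx C -> #|boundary C| <= torso_bound.
Proof.
move=> mC; have [_ _ _ nC] := maxadmP mC.
apply: leq_trans (leq_card_setU _ _) _; apply: leq_add => //.
have cn : #|near C| <= k * 4 ^ k.
  apply: leq_trans (_ : \sum_(s <- enum (nbh g C))
    #|[set C' | maxset (adm g (Z :|: ~: V) k) C' & s \in C']| <= _).
    apply: card_cover_seq => C'; rewrite inE => /andP[mC' /pred0Pn[s /andP[/= sC' sC]]].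
    by exists s; rewrite ?mem_enum // inE sC' andbT.
  apply: leq_trans (leq_mul nC (leqnn _)); rewrite big_enum -sum_nat_const.
  by apply: leq_sum => s _; apply: important_bound.
apply: leq_trans (_ : \sum_(C' <- enum (near C)) #|nbh g C'| <= _).
  apply: card_cover_seq => x /bigcupP[C' C'n xC'].
  by exists C'; rewrite ?mem_enum.
apply: leq_trans (leq_mul cn (leqnn _)); rewrite big_enum -sum_nat_const.
by apply: leq_sum => C'; rewrite inE => /andP[/maxadmP[]].
Qed.

(** A bag vertex of [C] is a neighbour of some maximal [C'], which then meets [C] or [nbh g C]. If
    [C'] missed [nbh g C], connectedness would put it inside [C], and maximality would give
    [C' = C], although [y] lies only in [C]. *)
Lemma mem_boundary C y : Mx C -> y \in torso_bag -> (y \in C) || (y \in nbh g C) ->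
  y \in boundary C.
Proof.
move=> mC yW /orP[yC|yN]; last by rewrite inE yN.
have [C' mC' yC'] : exists2 C', Mx C' & y \in nbh g C'.
  move: yW; rewrite !inE negb_and => /andP[/orP[/existsP[]|]].
    by exists C; rewrite mC.
  by rewrite negb_forall => /existsP[C']; rewrite negb_imply negbK => /andP[mC' h] _; exists C'.
rewrite inE; apply/orP; right; apply/bigcupP; exists C' => //; rewrite inE mC' /=.
have [yC'n [x xC' xy]] := nbhP _ _ _ yC'.
rewrite g_sym in xy; case/orP: (nbh_edge yC xy) => xC; last first.
  by apply/pred0Pn; exists x; rewrite /= xC'.
apply/negP => dj; have [_ /connP cC' _ _] := maxadmP mC'.
have sub : C' \subset C.
  apply: (cC' C x) => // a b aC aC' bC' ab; case/orP: (nbh_edge aC ab) => // bN.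
  by rewrite (disjointFr dj bC') in bN.
have /maxsetP[aC _] := mC; have /maxsetP[_ mmC'] := mC'.
by move: yC'n; rewrite -(mmC' C) ?yC.
Qed.

Definition comp K := maxset (fun K => [&& K != set0, conn g K & K \subset inner]) K.

Lemma innerV x : x \in inner -> x \in V :\: Z.
Proof.
by rewrite inE => /andP[/existsP[C /andP[/maxadmP[_ _ s _] xC]] _]; apply: (subsetP s).
Qed.

Lemma compP K : comp K -> [/\ K != set0, conn g K, K \subset inner & [disjoint nbh g K & inner]].
Proof.
move=> /maxsetP[/and3P[h1 h2 h3] mK]; split=> //.
have [K' [c' s' i' d']] := component g_sym h2 h3.
suff E : K' = K by rewrite -E.
apply: mK => //; rewrite c' i' !andbT; have /set0Pn[x xK] := h1.
by apply/set0Pn; exists x; apply: (subsetP s').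
Qed.

Lemma comp_cover x : x \in inner -> exists2 K, comp K & x \in K.
Proof.
move=> xi; have [|K mK sK] := maxset_exists
  (P := fun K => [&& K != set0, conn g K & K \subset inner]) (C := [set x]).
  by rewrite conn1 sub1set xi !andbT; apply/set0Pn; exists x; rewrite set11.
by exists K => //; apply: (subsetP sK); rewrite set11.
Qed.

Lemma comp_disjoint K K' : comp K -> comp K' -> K != K' -> [disjoint K & K'].
Proof.
move=> cK cK' ne; apply/pred0P => x /=; apply/negP => /andP[xK xK'].
have [n1 c1 s1 d1] := compP cK; have [n2 c2 s2 d2] := compP cK'.
have sub (A B : {set T}) : conn g B -> B \subset inner -> [disjoint nbh g A & inner] ->
    x \in A -> x \in B -> B \subset A.
  move=> /connP cB sB dA xA xB; apply: (cB A x) => // a b aA aB bB ab.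
  case/orP: (nbh_edge aA ab) => // bN.
  by have := subsetP sB _ bB; rewrite (disjointFr dA bN).
by case/eqP: ne; apply/eqP; rewrite eqEsubset (sub K' K c1 s1 d2 xK' xK) (sub K K').
Qed.

Lemma comp_nbh_bag K : comp K -> nbh g K \subset torso_bag.
Proof.
move=> /compP[_ _ _ d]; apply/subsetP => y yN; rewrite inE (disjointFr d yN) /=.
by have [_ [x _ /gV]] := nbhP _ _ _ yN.
Qed.

(** Leaving [C] means crossing [nbh g C], which contains no inner vertex. *)
Lemma comp_sub K C x : comp K -> Mx C -> x \in K -> x \in C -> K \subset C.
Proof.
move=> /compP[_ /connP cK sK _] mC xK xC; apply: (cK C x) => // a b aC aK bK ab.
case/orP: (nbh_edge aC ab) => // bN; have := subsetP sK _ bK.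
by rewrite inE => /andP[_ /forallP/(_ C)]; rewrite mC bN.
Qed.

Lemma comp_boundary K C x : comp K -> Mx C -> x \in K -> x \in C ->
  nbh g K \subset boundary C.
Proof.
move=> cK mC xK xC; have sKC := comp_sub cK mC xK xC.
apply/subsetP => y yN; apply: mem_boundary => //; first exact: (subsetP (comp_nbh_bag cK)).
have [_ [z zK zy]] := nbhP _ _ _ yN.
exact: nbh_edge (subsetP sKC _ zK) zy.
Qed.

Lemma card_comp_nbh K : comp K -> #|nbh g K| <= torso_bound.
Proof.
move=> cK; have [/set0Pn[x xK] _ sK _] := compP cK.
have := subsetP sK _ xK; rewrite inE => /andP[/existsP[C /andP[mC xC]] _].
apply: leq_trans (card_boundary mC).
exact: subset_leq_card (comp_boundary cK mC xK xC).
Qed.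

(** [Z] becomes a clique for glueing to the parent, and each component attachment for glueing the
    children. *)
Definition torso_rel x y := [&& x != y, x \in torso_bag, y \in torso_bag &
  [|| g x y, (x \in Z) && (y \in Z) |
      [exists K : {set T}, [&& comp K, x \in nbh g K & y \in nbh g K]]]].

Lemma torso_rel_sym : symmetric torso_rel.
Proof.
move=> x y; rewrite /torso_rel eq_sym g_sym [(x \in Z) && _]andbC.
have -> : [exists K : {set T}, [&& comp K, x \in nbh g K & y \in nbh g K]] =
    [exists K : {set T}, [&& comp K, y \in nbh g K & x \in nbh g K]].
  by apply: eq_existsb => K; rewrite [(x \in _) && _]andbC.
by case: (x \in torso_bag); case: (y \in torso_bag); rewrite ?andbF.
Qed.

Lemma torso_degree C x : Mx C -> x \in C -> x \in torso_bag ->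
  #|[set y | torso_rel x y]| <= torso_bound.
Proof.
move=> mC xC xW; apply: leq_trans (card_boundary mC); apply/subset_leq_card/subsetP => y.
rewrite inE => /and4P[_ _ yW /or3P[xy|/andP[xZ _]|/existsP[K /and3P[cK xK yK]]]].
- by apply: mem_boundary => //; apply: nbh_edge xC xy.
- have [_ _ s _] := maxadmP mC.
  by have := subsetP s _ xC; rewrite inE xZ.
have [_ [z zK zx]] := nbhP _ _ _ xK; rewrite g_sym in zx.
case/orP: (nbh_edge xC zx) => zC; first exact: (subsetP (comp_boundary cK mC zK zC)).
have [_ _ sK _] := compP cK; have := subsetP sK _ zK.
by rewrite inE => /andP[_ /forallP/(_ C)]; rewrite mC zC.
Qed.

Lemma covered_by_maximal x (C : {set T}) : x \in C -> C \subset V :\: Z -> #|nbh g C| <= k ->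
  exists2 C', Mx C' & x \in C'.
Proof.
move=> xC sC nC; have [K [cK xK sK dK]] := component g_sym (conn1 g x) (etrans (sub1set _ _) xC).
have [|C' mC' sC'] := maxset_exists (P := adm g (Z :|: ~: V) k) (C := K).
  apply/and4P; split=> //; first by apply/set0Pn; exists x; apply: (subsetP xK); rewrite set11.
    apply: disjointWl sK _; rewrite disjoints_subset setCU setCK setIC -setDE; exact: sC.
  exact: leq_trans (subset_leq_card (component_nbh sK dK)) nC.
by exists C' => //; apply: (subsetP sC'); apply: (subsetP xK); rewrite set11.
Qed.

End Torso.

Lemma colourable_on_weaken (T : finType) (e : rel T) (U : {set T}) c c' :
  c <= c' -> colourable_on e U c -> colourable_on e U c'.
Proof.
by move=> le [f [fb fn]]; exists f; split=> // x xU; apply: leq_trans (fb x xU) le.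
Qed.

(** A vertex of [X] has a private colour and cannot match its partner in the other half, so
    repetitive paths avoid [X]. *)
Lemma colourable_on_exceptional (T : finType) (e : rel T) (W X : {set T}) D :
  symmetric e -> 0 < D ->
  (forall x, x \in W :\: X -> #|[set y in W :\: X | e x y]| <= D) ->
  colourable_on e W (4 * D * D + 4 * D + #|X|).
Proof.
move=> e_sym D0 deg; have [f [fb fn]] := bounded_degree_colourable e_sym D0 deg.
set c0 := 4 * D * D + 4 * D in fb *.
pose f' x := if x \in X then c0 + index x (enum X) else f x.
exists f'; split=> [x xW|s1 s2 srt u aW eqf].
  rewrite /f'; case: ifP => xX; first by rewrite ltn_add2l cardE index_mem mem_enum.
  by apply: ltn_addr; apply: fb; rewrite inE xX.
have sz : size s1 = size s2 by rewrite -(size_map f') eqf size_map.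
have uniqX x y : x \in X -> y \in W -> f' x = f' y -> x = y.
  move=> xX yW; rewrite /f' xX; case: ifP => yX.
    by move/addnI/(congr1 (nth x (enum X))); rewrite !nth_index ?mem_enum.
  move=> E; have := fb y; rewrite inE yX yW -E => /(_ isT).
  by rewrite ltnNge leq_addr.
have [aW1 aW2] : {subset s1 <= W} /\ {subset s2 <= W}.
  by split=> x xs; apply: (allP aW); rewrite mem_cat xs ?orbT.
have dj x : x \in s1 -> x \notin s2.
  by move=> x1; move: u; rewrite cat_uniq => /and3P[_ /hasPn h _]; apply/negP => /h; rewrite /= x1.
have n1 x : x \in s1 -> x \notin X.
  move=> x1; apply/negP => xX.
  have [y y2 /(_ f' eqf) E] := @map_eq_partner _ nat _ _ _ sz x1.
  by have := dj x x1; rewrite (uniqX x y xX (aW2 _ y2) E) y2.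
have n2 x : x \in s2 -> x \notin X.
  move=> x2; apply/negP => xX.
  have [y y1 /(_ f' (esym eqf)) E] := @map_eq_partner _ nat _ _ _ (esym sz) x2.
  by have := dj y y1; rewrite -(uniqX x y xX (aW1 _ y1) E) x2.
apply: (fn s1 s2) => //.
  apply/allP => x; rewrite /= mem_cat inE => /orP[x1|x2]; first by rewrite n1 // aW1.
  by rewrite n2 // aW2.
have E s : (forall x, x \in s -> x \notin X) -> map f s = map f' s.
  by move=> h; apply/eq_in_map => x /h xX; rewrite /f' (negPf xX).
by rewrite !E.
Qed.

(** * Merging decompositions of two graphs along a clique *)

Section Merge.
Variables (T : finType) (k c : nat).
Notation grow_col e := (grow k e (fun B => colourable_on e B c)).

Lemma grow_sub (e : rel T) (Z U : {set T}) : grow_col e Z U -> Z \subset U.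
Proof. by elim=> // U' B _ s _ _ _ _; apply: subset_trans s (subsetUl _ _). Qed.

Lemma colourable_on_ext (e1 e2 : rel T) (U : {set T}) :
  (forall x y, x \in U -> y \in U -> e1 x y = e2 x y) ->
  colourable_on e1 U c -> colourable_on e2 U c.
Proof.
move=> E [f [fb fn]]; exists f; split=> // s1 s2 srt u aU; apply: fn => //.
by rewrite (eq_in_sorted (P := mem U) (e := e1) (e' := e2)).
Qed.

Lemma grow_ext (e1 e2 : rel T) (Z U : {set T}) :
  (forall x y, x \in U -> y \in U -> e1 x y = e2 x y) ->
  grow_col e1 Z U -> grow_col e2 Z U.
Proof.
move=> E gU; elim: gU E => [|U' B gU IH goodB cA cl noe] E; first exact: GrowRefl.
have EU x y : x \in U' -> y \in U' -> e1 x y = e2 x y.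
  by move=> xU yU; apply: E; rewrite inE ?xU ?yU.
have EB x y : x \in B -> y \in B -> e1 x y = e2 x y.
  by move=> xU yU; apply: E; rewrite inE ?xU ?yU orbT.
apply: GrowGlue => //; first exact: IH.
- exact: colourable_on_ext goodB.
- move=> x y xA yA ne; rewrite -EU; [exact: cl| by have /setIP[] := xA | by have /setIP[] := yA].
- by move=> x y xU xB yB yU; rewrite -E ?inE ?xU ?yB ?orbT //; apply: noe.
Qed.

(** Both relations are complete on [U :&: V2], so their union adds nothing inside [U] or [V2]. The
    second growth is replayed on top of [U]; since it starts from [U :&: V2], its bags meet [U] only
    in vertices already present, and the overlaps are unchanged. *)
Lemma grow_merge (e1 e2 : rel T) (Z U V2 : {set T}) :
  (forall x y, e1 x y -> (x \in U) && (y \in U)) -> (forall x y, e2 x y -> (x \in V2) && (y \in V2)) ->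
  irreflexive e1 -> irreflexive e2 ->
  clique e1 (U :&: V2) -> clique e2 (U :&: V2) ->
  grow_col e1 Z U -> grow_col e2 (U :&: V2) V2 ->
  grow_col (relU e1 e2) Z (U :|: V2).
Proof.
move=> c1 c2 i1 i2 cl1 cl2 g1 g2; set e := relU e1 e2.
have ge1 : grow_col e Z U.
  apply: grow_ext g1 => x y xU yU; rewrite /e /=.
  case: (boolP (e2 x y)) => h; last by rewrite orbF.
  have /andP[xV yV] := c2 _ _ h; rewrite cl1 ?inE ?xU ?yU //.
  by apply: contraTneq h => ->; rewrite i2.
have ge2 : grow_col e (U :&: V2) V2.
  apply: grow_ext g2 => x y xV yV; rewrite /e /=.
  case: (boolP (e1 x y)) => h //=.
  have /andP[xU yU] := c1 _ _ h; rewrite cl2 ?inE ?xU ?yU //.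
  by apply: contraTneq h => ->; rewrite i1.
suff h V' : grow_col e (U :&: V2) V' -> V' \subset V2 -> grow_col e Z (U :|: V').
  exact: h ge2 (subxx _).
elim=> {V'} [|U' B gU IH goodB cA cl noe]; first by rewrite setUIr setUid (setIidPl (subsetUl _ _)).
rewrite subUset => /andP[sU sB]; rewrite setUA.
have sN := grow_sub gU.
have EA : (U :|: U') :&: B = U' :&: B.
  apply/setP => x; rewrite !inE; case xU: (x \in U) => //=; case xB: (x \in B); rewrite ?andbF //.
  by rewrite (subsetP sN) // inE xU (subsetP sB).
apply: GrowGlue; rewrite ?EA //; first exact: IH.
move=> x y xU xB yB; rewrite inE negb_or => /andP[yU yU'].
have [xU'|xU'] := boolP (x \in U'); first exact: noe.
rewrite inE (negPf xU') orbF in xU.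
apply/negP => /orP[/c1/andP[_]|/c2/andP[xV _]]; first by rewrite (negPf yU).
by move: xU'; rewrite (subsetP sN) // inE xU.
Qed.

Lemma grow_first_bag (e : rel T) (Z W U : {set T}) : Z \subset W -> #|Z| <= k -> clique e Z ->
  colourable_on e W c -> grow_col e W U -> grow_col e Z U.
Proof.
move=> sZW cZ clZ gW; elim=> [|U' B _ IH]; last exact: GrowGlue.
have EI : Z :&: W = Z by apply/setIidPl.
rewrite -(setUidPr sZW); apply: GrowGlue; rewrite ?EI //; first exact: GrowRefl.
by move=> x y xZ; rewrite (subsetP sZW).
Qed.

End Merge.

(** * The recursive decomposition *)

Section Structure.
Variables H G : sgraph.
Hypothesis noimm : ~ contains_strong_immersion H G.
Let N := #|H|.
Let p := N * N + N.
Let b := torso_bound (2 * p).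
(** Large enough for the bound on free vertices, and larger than [b], so that no attachment of a
    deleted component contains a root of size [q]. *)
Let q := b + 4 * p + 1.
(** Colours for degree [b.+1], then private ones: [q] for [Z] and [N] for the free vertices. The
    last summand lets a bag of order [q + p] be coloured injectively. *)
Let c := 4 * b.+1 * b.+1 + 4 * b.+1 + (q + N + p).

Definition decomposed (V Z : {set G}) := exists e : rel G,
  [/\ symmetric e, irreflexive e, forall x y, e x y -> (x \in V) && (y \in V),
      forall x y, x \in V -> y \in V -> adj x y -> e x y
    & clique e Z /\ grow q e (fun B => colourable_on e B c) Z V].

(** A graph [H] without vertices is immersed in everything. *)
Lemma p_gt0 : 0 < p.
Proof.
rewrite /p; have [N0|] := posnP N; last by case: N.
exfalso; apply: noimm; have noH (h : H) : False by have := card0_eq N0 h; rewrite inE.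
exists (fun h => False_rect G (noH h)), (fun=> [::]).
by split=> [|e _ h]; [split=> [h|h|e e']; [case: (noH h)..|rewrite inE => /existsP[h]; case: (noH h)]
  | case: (noH h)].
Qed.

Lemma small_colourable (e : rel G) (B : {set G}) : symmetric e -> #|B| <= q + p ->
  colourable_on e B c.
Proof.
move=> e_sym cB; apply: colourable_on_weaken (colourable_on_exceptional (D := b.+1) (X := B) _ _ _) => //.
  by rewrite /c leq_add2l; move: cB; clear; lia.
by move=> x; rewrite setDv inE.
Qed.

Definition complete (W : {set G}) : rel G := fun x y => [&& x != y, x \in W & y \in W].

Lemma complete_sym W : symmetric (complete W).
Proof. by move=> x y; rewrite /complete eq_sym; congr (_ && _); rewrite andbC. Qed.

Lemma complete_clique (W A : {set G}) : A \subset W -> clique (complete W) A.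
Proof. by move=> s x y xA yA ne; rewrite /complete ne !(subsetP s). Qed.

Lemma grow_bag (e : rel G) (W Z : {set G}) : Z \subset W -> #|Z| <= q ->
  clique e Z -> colourable_on e W c -> grow q e (fun B => colourable_on e B c) Z W.
Proof. by move=> s cZ cl col; apply: (grow_first_bag s) => //; apply: GrowRefl. Qed.

Lemma decomposed_small (V Z : {set G}) : Z \subset V -> #|V| <= q + p -> #|Z| <= q -> decomposed V Z.
Proof.
move=> s cV cZ; exists (complete V); split.
- exact: complete_sym.
- by move=> x; rewrite /complete eqxx.
- by move=> x y /andP[].
- move=> x y xV yV xy; rewrite /complete xV yV !andbT.
  by apply: contraTneq xy => ->; rewrite adj_irr.
have cl := complete_clique s; split=> //.
have cs := @complete_sym V.
by apply: grow_bag => //; apply: small_colourable.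
Qed.

Lemma decomposed_pad (V Z Z' : {set G}) : Z \subset Z' -> #|Z'| <= q ->
  decomposed V Z' -> decomposed V Z.
Proof.
move=> s cZ [e [es ei ec ea [cl gr]]]; exists e; split=> //.
have clZ : clique e Z by move=> x y xZ yZ; apply: cl; apply: (subsetP s).
split=> //; apply: grow_first_bag gr => //; first exact: leq_trans (subset_leq_card s) cZ.
by apply: small_colourable => //; apply: leq_trans cZ (leq_addr _ _).
Qed.

(** The root bag is the complete graph on [Z :|: (A :&: B)], to which the decompositions of [A] and
    [B] are glued in turn. *)
Lemma decomposed_split (V Z A B : {set G}) : Z \subset V -> #|Z| <= q -> separation V A B ->
  #|A :&: B| <= p ->
  decomposed A ((Z :&: A) :|: (A :&: B)) -> decomposed B ((Z :&: B) :|: (A :&: B)) ->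
  decomposed V Z.
Proof.
move=> sZV cZ /separationP[EV noe] cAB [eA [As Ai Ac Aa [Acl Agr]]] [eB [Bs Bi Bc Ba [Bcl Bgr]]].
pose W := Z :|: (A :&: B); pose e0 := complete W.
have e0s : symmetric e0 by apply: complete_sym.
have e0i : irreflexive e0 by move=> x; rewrite /e0 /complete eqxx.
have e0c x y : e0 x y -> (x \in W) && (y \in W) by case/andP.
have sZW : Z \subset W by apply: subsetUl.
have cW : #|W| <= q + p by apply: leq_trans (leq_card_setU _ _) (leq_add cZ cAB).
have g0 : grow q e0 (fun B => colourable_on e0 B c) Z W.
  apply: grow_bag => //; first exact: complete_clique.
  exact: small_colourable.
have EA : W :&: A = (Z :&: A) :|: (A :&: B).
  by apply/setP => x; rewrite !inE; case: (x \in A); rewrite ?andbF ?andbT.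
have EB : (W :|: A) :&: B = (Z :&: B) :|: (A :&: B).
  by apply/setP => x; rewrite !inE; case: (x \in A); case: (x \in B); rewrite ?andbF ?andbT ?orbT ?orbF.
have clW (X : {set G}) : X \subset W -> clique e0 X by apply: complete_clique.
have g1 : grow q (relU e0 eA) (fun B => colourable_on (relU e0 eA) B c) Z (W :|: A).
  apply: grow_merge; rewrite ?EA //; apply: clW; rewrite -EA; exact: subsetIl.
have g2 : grow q (relU (relU e0 eA) eB) (fun B => colourable_on (relU (relU e0 eA) eB) B c) Z
    ((W :|: A) :|: B).
  apply: grow_merge; rewrite ?EB //.
  - by move=> x y /orP[/e0c|/Ac] /andP[h1 h2]; rewrite !(in_setU _ W A) h1 h2 ?orbT.
  - by move=> x; rewrite /= e0i Ai.
  - move=> x y xB yB ne; apply/orP; left; apply: (clW _ _ x y xB yB ne).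
    by apply/subsetP => z; rewrite !inE => /orP[/andP[->]|->]; rewrite ?orbT.
have EVW : (W :|: A) :|: B = V.
  rewrite -setUA EV; apply/setUidPr; rewrite subUset sZV -EV.
  exact: subset_trans (subsetIl _ _) (subsetUl _ _).
rewrite EVW in g2; exists (relU (relU e0 eA) eB); split.
- by move=> x y /=; rewrite e0s As Bs.
- by move=> x /=; rewrite e0i Ai Bi.
- move=> x y exy; rewrite -EVW !(in_setU _ _ B) !(in_setU _ W A).
  by case/orP: exy => [/orP[/e0c|/Ac]|/Bc] /andP[-> ->]; rewrite ?orbT.
- move=> x y xV yV xy; rewrite -EV !in_setU in xV yV.
  apply/orP; have [xA|xA] := boolP (x \in A); have [yA|yA] := boolP (y \in A).
  + by left; apply/orP; right; apply: Aa.
  + rewrite (negPf yA) /= in yV; right; apply: Ba => //.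
    by apply/negPn/negP => xB; have := noe x y xA xB yV yA; rewrite xy.
  + rewrite (negPf xA) /= in xV; right; apply: Ba => //.
    by apply/negPn/negP => yB; have := noe y x yA yB xV xA; rewrite adj_sym xy.
  + by rewrite (negPf xA) (negPf yA) /= in xV yV; right; apply: Ba.
by split=> // x y xZ yZ ne; apply/orP; left; apply/orP; left; apply: (clW Z sZW).
Qed.

Lemma decomposed_torso (V Z : {set G}) : Z \subset V -> #|Z| = q ->
  (forall A B, separation V A B -> #|A :&: B| <= p -> #|Z :\: A| < p \/ #|Z :\: B| < p) ->
  (forall V' Z' : {set G}, #|V'| < #|V| -> Z' \subset V' -> #|Z'| <= q -> decomposed V' Z') ->
  decomposed V Z.
Proof.
move=> sZV cZ unsplit rec.
pose g := induced V; pose W := torso_bag g V Z (2 * p).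
pose cmp := comp g V Z (2 * p); pose e0 := torso_rel g V Z (2 * p).
have gs : symmetric g := @induced_sym _ V.
have gV x y : g x y -> y \in V by case/and3P.
have few : #|free H V Z| <= N.
  by apply: (free_few noimm) => //; rewrite cZ /q; clear; rewrite /p /N; lia.
have e0s : symmetric e0 by apply: torso_rel_sym.
have e0i : irreflexive e0 by move=> x; rewrite /e0 /torso_rel eqxx.
have e0c x y : e0 x y -> (x \in W) && (y \in W) by case/and4P=> _ -> ->.
have innV x : x \in inner g V Z (2 * p) -> (x \in V) && (x \notin Z).
  by move/innerV; rewrite inE andbC.
have sZW : Z \subset W.
  apply/subsetP => x xZ; rewrite inE (subsetP sZV) // andbT.
  by apply/negP => /innV; rewrite xZ andbF.
have clZ : clique e0 Z.
  by move=> x y xZ yZ ne; rewrite /e0 /torso_rel ne !(subsetP sZW) // xZ yZ orbT.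
(* A bag vertex outside [Z] that is not free lies in some maximal set, and thus has bounded torso
   degree. *)
have colW : colourable_on e0 W c.
  apply: colourable_on_weaken (colourable_on_exceptional (D := b.+1) (X := Z :|: free H V Z) _ _ _) => //.
    rewrite /c leq_add2l; apply: leq_trans (leq_card_setU _ _) _; rewrite cZ.
    by move: few; clear; lia.
  move=> x; rewrite !in_setD in_setU negb_or => /andP[/andP[xZ xF] /andP[xi xV]].
  have [C mC xC] : exists2 C, maxset (adm g (Z :|: ~: V) (2 * p)) C & x \in C.
    move: xF; rewrite inE in_setD xZ xV /= negb_forall => /existsP[C].
    rewrite negb_imply -leqNgt => /andP[/andP[xC sC] nC].
    exact: (covered_by_maximal gs xC sC nC).
  have xW : x \in W by rewrite in_setD xi.
  apply: leq_trans (leqW (torso_degree gs gV mC xC xW)).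
  by apply/subset_leq_card/subsetP => y; rewrite inE => /andP[_]; rewrite inE.
have g0 : grow q e0 (fun B => colourable_on e0 B c) Z W by apply: grow_bag; rewrite ?cZ.
(* The attachment has at most [b < q] vertices, so it misses a vertex of [Z], which [K] avoids as
   well; the piece is therefore smaller than [V]. *)
have child K : cmp K -> decomposed (K :|: nbh g K) (nbh g K).
  move=> cK; have [_ _ sK _] := compP gs cK.
  have cN : #|nbh g K| <= b := card_comp_nbh gs gV cK.
  have leq' : #|nbh g K| < q by apply: leq_ltn_trans cN _; rewrite /q; clear; lia.
  apply: rec; [|exact: subsetUr|exact: ltnW].
  apply: proper_card; apply/properP; split.
    rewrite subUset; apply/andP; split.
      by apply/subsetP => x /(subsetP sK)/innV/andP[].
    by apply/subsetP => x /nbhP[_ [y _ /gV]].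
  have /subsetPn[z zZ zN] : ~~ (Z \subset nbh g K).
    by apply/negP => /subset_leq_card; rewrite cZ leqNgt leq'.
  exists z; first exact: (subsetP sZV).
  rewrite inE (negPf zN) orbF; apply/negP => /(subsetP sK)/innV.
  by rewrite zZ andbF.
have clN K : cmp K -> clique e0 (nbh g K).
  move=> cK x y xK yK ne; have sW := subsetP (comp_nbh_bag gs gV cK).
  rewrite /e0 /torso_rel ne !sW //=; apply/or3P; constructor 3.
  by apply/existsP; exists K; apply/and3P.
pose cov (ks : seq {set G}) := [set x | has (fun K : {set G} => x \in K) ks].
have many (ks : seq {set G}) : uniq ks -> all cmp ks -> exists e : rel G,
    [/\ symmetric e, irreflexive e,
        forall x y, e x y -> (x \in W :|: cov ks) && (y \in W :|: cov ks),
        subrel e0 e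
      & (forall K x y, K \in ks -> x \in K :|: nbh g K -> y \in K :|: nbh g K -> adj x y -> e x y) /\
        grow q e (fun B => colourable_on e B c) Z (W :|: cov ks)].
  elim: ks => [|K ks IH] /=.
    have -> : cov [::] = set0 by apply/setP => x; rewrite !inE.
    by move=> _ _; exists e0; split=> //; rewrite setU0.
  move=> /andP[Kks uks] /andP[cK aks].
  have [e1 [s1 i1 c1 sub1 [a1 g1]]] := IH uks aks.
  have [e2 [s2 i2 c2 a2 [cl2 g2]]] := child K cK.
  set U := W :|: _ in c1 g1.
  have EI : U :&: (K :|: nbh g K) = nbh g K.
    apply/setP => x; rewrite in_setI in_setU; have [xN|xN] := boolP (x \in nbh g K).
      by rewrite orbT andbT /U in_setU (subsetP (comp_nbh_bag gs gV cK)).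
    rewrite orbF; apply/negP => /andP[xU xK].
    have [_ _ sK _] := compP gs cK; have xi := subsetP sK _ xK.
    move: xU; rewrite in_setU => /orP[|]; first by rewrite in_setD xi.
    rewrite inE => /hasP[K' K'ks xK'].
    have ne : K != K' by apply: contraNneq Kks => ->.
    by have := disjointFr (comp_disjoint gs cK (allP aks _ K'ks) ne) xK; rewrite xK'.
  have EU : W :|: cov (K :: ks) = U :|: (K :|: nbh g K).
    apply/setP => x; rewrite /U !in_setU [x \in cov (K :: ks)]inE [x \in cov ks]inE /=.
    case xN: (x \in nbh g K); last by rewrite orbF orbA orbAC.
    by rewrite (subsetP (comp_nbh_bag gs gV cK)).
  rewrite EU; exists (relU e1 e2); split.
  - by move=> x y; rewrite /= s1 s2.
  - by move=> x; rewrite /= i1 i2.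
  - by move=> x y /orP[/c1|/c2] /andP[h1 h2]; rewrite !(in_setU _ U) h1 h2 ?orbT.
  - by move=> x y /sub1 h; rewrite /= h.
  split.
    move=> K' x y; rewrite inE => /orP[/eqP ->|h] xK yK xy; apply/orP; [right|left].
      exact: a2.
    exact: (a1 K').
  apply: grow_merge; rewrite ?EI //.
  by move=> x y xK yK ne; apply: sub1; apply: (clN K).
have [||e [es ei ec esub [ea gr]]] := many (enum [set K | cmp K]).
- exact: enum_uniq.
- by apply/allP => K; rewrite mem_enum inE.
have EV : W :|: cov (enum [set K | cmp K]) = V.
  apply/setP => x; rewrite in_setU; apply/orP/idP.
    case; first by rewrite in_setD => /andP[].
    rewrite inE => /hasP[K]; rewrite mem_enum inE => cK xK; have [_ _ sK _] := compP gs cK.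
    by have /innV/andP[] := subsetP sK _ xK.
  move=> xV; have [xi|xi] := boolP (x \in inner g V Z (2 * p)); last by left; rewrite in_setD xi.
  have [K cK xK] := comp_cover xi.
  by right; rewrite inE; apply/hasP; exists K; rewrite ?xK // mem_enum inE.
rewrite EV in ec gr; exists e; split=> //; last by split=> // x y xZ yZ ne; apply: esub; apply: clZ.
move=> x y xV yV xy.
have inn u v : u \in V -> v \in V -> adj u v -> u \in inner g V Z (2 * p) -> e u v.
  move=> uV vV uv ui; have [K cK uK] := comp_cover ui.
  have guv : g u v by rewrite /g /induced uv uV.
  apply: (ea K) => //; first by rewrite mem_enum inE.
    by rewrite in_setU uK.
  by rewrite in_setU; apply: nbh_edge uK guv.
have [xi|xi] := boolP (x \in inner g V Z (2 * p)); first exact: inn.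
have [yi|yi] := boolP (y \in inner g V Z (2 * p)); first by rewrite es; apply: inn; rewrite // adj_sym.
apply: esub; rewrite /e0 /torso_rel !in_setD xi yi xV yV /g /induced xy xV yV /= andbT.
by apply: contraTneq xy => ->; rewrite adj_irr.
Qed.

(** Induction on the order of [V], with [Z] first enlarged to order [q]. If a separation of order at
    most [p] leaves at least [p] vertices of [Z'] off each side, both sides are decomposed;
    otherwise the torso is the root bag. *)
Theorem decomposition (V Z : {set G}) : Z \subset V -> #|Z| <= q -> decomposed V Z.
Proof.
move En : #|V| => n; elim/ltn_ind: n V En Z => n IHn V En Z sZV cZ.
have [cV|cV] := leqP #|V| q.
  by apply: decomposed_small => //; apply: leq_trans cV (leq_addr _ _).
have [Z' sZ' [sZ'V cZ']] : exists2 Z' : {set G}, Z \subset Z' & Z' \subset V /\ #|Z'| = q.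
  elim: {Z cZ sZV}(q - #|Z|) {-2}Z (erefl (q - #|Z|)) sZV cZ => [|m IHm] Z Em sZV cZ.
    by exists Z => //; split=> //; apply/eqP; rewrite eqn_leq cZ -subn_eq0 Em eqxx.
  have /subsetPn[x xV xZ] : ~~ (V \subset Z).
    by apply/negP => /subset_leq_card; rewrite leqNgt (leq_ltn_trans cZ cV).
  have cx : #|x |: Z| = #|Z|.+1 by rewrite cardsU1 xZ.
  have [|||Z' s1 s2] := IHm (x |: Z).
  - by rewrite cx subnS Em.
  - by rewrite subUset sub1set xV.
  - by rewrite cx -subn_gt0 Em.
  by exists Z' => //; apply: subset_trans s1; apply: subsetUr.
apply: (decomposed_pad sZ'); first by rewrite cZ'.
have rec (V' Z0 : {set G}) : #|V'| < #|V| -> Z0 \subset V' -> #|Z0| <= q -> decomposed V' Z0.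
  by rewrite En => lt s c0; apply: (IHn _ lt V' erefl).
case: (boolP [exists A : {set G}, exists B : {set G}, [&& separation V A B, #|A :&: B| <= p,
    p <= #|Z' :\: A| & p <= #|Z' :\: B|]]) => [/existsP[A /existsP[B /and4P[sep o zA zB]]]|no].
  have /separationP[EV _] := sep.
  (* At least [p > 0] vertices of [Z'] lie outside [X]: hence [X] is smaller than [V], and
     exchanging them for the overlap keeps the new root within [q]. *)
  have side (X : {set G}) : X \subset V -> A :&: B \subset X -> p <= #|Z' :\: X| ->
      decomposed X ((Z' :&: X) :|: (A :&: B)).
    move=> sX sAB zX; apply: rec.
    - apply: proper_card; apply/properP; split=> //.
      have /set0Pn[z] : Z' :\: X != set0 by rewrite -card_gt0; apply: leq_trans p_gt0 zX.
      by rewrite in_setD => /andP[zX' zZ]; exists z => //; apply: (subsetP sZ'V).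
    - by rewrite subUset subsetIr.
    - apply: leq_trans (leq_card_setU _ _) _; have := cardsID X Z'; rewrite cZ'.
      by move: o zX; clear; lia.
  apply: (decomposed_split sZ'V _ sep o); first by rewrite cZ'.
    by apply: side => //; [rewrite -EV subsetUl | exact: subsetIl].
  by apply: side => //; [rewrite -EV subsetUr | exact: subsetIr].
apply: decomposed_torso => // A B sep o.
have [|zA] := ltnP #|Z' :\: A| p; first by left.
have [|zB] := ltnP #|Z' :\: B| p; first by right.
by case/negP: no; apply/existsP; exists A; apply/existsP; exists B; rewrite sep o zA.
Qed.

Lemma nonrepetitively_colourable_of_decomposition :
  nonrepetitively_colourable G (c * (24 * 3) ^ q).
Proof.
have [e [es _ _ ea [_ gr]]] : decomposed setT set0.
  by apply: decomposition; rewrite ?sub0set ?cards0.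
have [f [fb fn]] := grow_colourable es gr.
exists (fun x => Ordinal (fb x (in_setT x))) => s /andP[srt us] sn [m [sz rep]].
have x0 : G by case: s sn {srt us sz rep}.
have sz1 : size (take m s) = m by rewrite size_takel // sz -addnn leq_addr.
suff /(congr1 size) : take m s = [::].
  by rewrite sz1 /= => m0; apply: sn; apply: size0nil; rewrite sz m0.
apply: (fn _ (drop m s)); rewrite ?cat_take_drop //.
- by apply: sub_sorted srt => x y; apply: ea; rewrite inE.
- by apply/allP => x _; rewrite /= inE.
apply: (@eq_from_nth _ 0).
  by rewrite !size_map sz1 size_drop sz -addnn addnK.
move=> i; rewrite size_map sz1 => im.
rewrite !(nth_map x0) ?sz1 ?size_drop ?sz -?addnn ?addnK //.
by rewrite nth_take // nth_drop; have /(congr1 val) := rep x0 i im.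
Qed.

End Structure.

Theorem theorem4 :
  forall H : sgraph, exists k : nat, forall G : sgraph,
    ~ contains_strong_immersion H G -> nonrepetitively_colourable G k.
Proof.
(* The constant is found by unification before [G] is introduced, so it depends on [H] alone. *)
move=> H; eexists => G; exact: nonrepetitively_colourable_of_decomposition.
Qed.
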